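(* Let $Q\in\mathcal B$ and $0<\alpha_0<1$. Suppose there exists $0<\delta<\alpha_0$ such that $\mathcal D^{\alpha_0-\delta,\alpha_0}_1(Q)>-\infty$, and suppose $\lim_{\epsilon\downarrow0}\epsilon\,\mathcal D^{\alpha_0,\alpha_0+\epsilon}_{1,\epsilon}(Q)=0$. Then the function $(0,1)\ni x\mapsto\mathcal H_x(\Lambda,\phi_0)(Q)$ is right differentiable at $\alpha_0$, and $$\left.\frac{d_+}{d_+x}\mathcal H_x(\Lambda,\phi_0)(Q)\right|_{x=\alpha_0}=\mathcal D^{\alpha_0,\alpha_0}_1(Q)=\lim_{x\to\alpha_0,\ x>\alpha_0}\mathcal D^{\alpha_0,x}_1(Q),$$ where $d_+/d_+x$ denotes the right derivative.
   Context: Setting. Let $X$ be a set, $S:X\to X$ a bijection, $\mathcal A$ a $\sigma$-algebra on $X$, $\mathcal A_0$ the $\sigma$-algebra generated by $\bigcup_{i\ge 0}S^{-i}\mathcal A$, $\mathcal B$ the $\sigma$-algebra generated by $\bigcup_{i\in\mathbb Z}S^{-i}\mathcal A$, and $\mathcal A_m:=S^{-m}\mathcal A_0=\{S^{-m}A:A\in\mathcal A_0\}$ for integers $m\le 0$ (so $\mathcal A_0\subset\mathcal A_{-1}\subset\cdots$). Let $\phi_0$ be a finite positive measure on $\mathcal A_0$, and $\Lambda$ a finite positive measure on $\mathcal A_0$ with $\Lambda\circ S^{-1}=\Lambda$ and $\Lambda\ll\phi_0$; let $Z\ge0$ be an $\mathcal A_0$-measurable version of $d\Lambda/d\phi_0$.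 For $Q\subset X$ let $\mathcal C(Q)$ be the set of all sequences $(A_m)_{m\le0}$ with $A_m\in\mathcal A_m$ for all $m\le 0$ and $Q\subset\bigcup_{m\le0}A_m$. The symbol $\Lambda$ also denotes $\Lambda(Q):=\inf_{(A_m)\in\mathcal C(Q)}\sum_{m\le0}\Lambda(S^mA_m)$, $Q\subset X$; its restriction to $\mathcal B$ is the unique $S$-invariant measure on $\mathcal B$ extending $\Lambda$. Conventions: extended real numbers are used, $0\log0:=0$, $y^x:=e^{x\log y}$ and thus $0^0:=1$; $Z^\alpha\log Z:=0$ where $Z=0$ ($\alpha>0$). For $\alpha\ge0$ and $Q\subset X$: $\mathcal H_\alpha(\Lambda,\phi_0)(Q):=\inf_{(A_m)\in\mathcal C(Q)}\sum_{m\le0}\int_{S^mA_m}Z^\alpha d\phi_0$. For $\epsilon>0$ and $0\le\beta\le1$: $\mathcal C^1_\epsilon(Q):=\{(A_m)\in\mathcal C(Q):\sum_{m\le0}\Lambda(S^mA_m)<\Lambda(Q)+\epsilon\}$; $\mathcal H^{\beta,1}(\Lambda,\phi_0)(Q):=\lim_{\epsilon\to0}\inf_{(A_m)\in\mathcal C^1_\epsilon(Q)}\sum_{m\le0}\int_{S^mA_m}Z^\beta d\phi_0$; $\mathcal C^{\beta,1}_\epsilon(Q):=\{(A_m)\in\mathcal C^1_\epsilon(Q):\sum_{m\le0}\int_{S^mA_m}Z^\beta d\phi_0<\mathcal H^{\beta,1}(\Lambda,\phi_0)(Q)+\epsilon\}$. For $0<\alpha\le1$ and $0\le\beta\le1$: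 $\mathcal D^{\alpha,\beta}_{1,\epsilon}(Q):=\inf_{(A_m)\in\mathcal C^{\beta,1}_\epsilon(Q)}\sum_{m\le0}\int_{S^mA_m}Z^\alpha\log Z\,d\phi_0$ and $\mathcal D^{\alpha,\beta}_1(Q):=\lim_{\epsilon\to0}\mathcal D^{\alpha,\beta}_{1,\epsilon}(Q)$. *)

(* Defs.v *)
From HB Require Import structures.
From mathcomp Require Import all_boot all_order all_algebra.
From mathcomp Require Import all_classical all_reals all_analysis.
From mathcomp Require Import measurable_realfun.

Set Implicit Arguments.
Unset Strict Implicit.
Unset Printing Implicit Defensive.

Import Order.TTheory GRing.Theory Num.Theory.
Import numFieldNormedType.Exports.

Local Open Scope classical_set_scope.
Local Open Scope ring_scope.

Section sigma_algebras.
Context {X : Type}.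
Implicit Types (S : X -> X) (A : set (set X)).

(* S^{-i} B for i : int; when S is a bijection, the image under the n-th
   iterate of S is the preimage under S^{-n} *)
Definition spre S (i : int) (B : set X) : set X :=
  match i with
  | Posz n => iter n S @^-1` B
  | Negz n => iter n.+1 S @` B
  end.

Definition gen0 S A : set (set X) := \bigcup_(n : nat) (spre S n%:Z @` A).

Definition sigA0 S A : set (set X) := <<s gen0 S A >>.

Definition sigB S A : set (set X) :=
  <<s \bigcup_(i : int) (spre S i @` A) >>.

Definition sigAm S A (m : int) : set (set X) := spre S m @` sigA0 S A.

(* Sequences over the integers m <= 0 are indexed by the naturals k = -m:
   F k stands for A_{-k}, and S^m A_m is spre S k (F k). *)
Definition covers S A (Q : set X) : set (nat -> set X) :=
  [set F | (forall k : nat, sigAm S A (- k%:Z) (F k)) /\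
           Q `<=` \bigcup_k F k].

End sigma_algebras.

Section dynamically_defined.
Local Open Scope ereal_scope.
Context {R : realType} {X : pointedType}.
Variables (S : X -> X) (A : set (set X)).

Notation X0 := (g_sigma_algebraType (gen0 S A)).

Variables (phi Lam : {finite_measure set X0 -> \bar R}) (Z : X -> \bar R).

Definition RN_version : Prop :=
  [/\ forall x, 0 <= Z x, measurable_fun [set: X0] (Z : X0 -> \bar R) &
      forall B : set X0, measurable B ->
        Lam B = \int[phi]_(x in B) (Z x)].

Definition Lsum (F : nat -> set X) : \bar R :=
  \sum_(k <oo) Lam (spre S k%:Z (F k)).

(* the outer measure extending Lam, also written Lambda *)
Definition Lout (Q : set X) : \bar R := ereal_inf (Lsum @` covers S A Q).

(* 0 `^ 0 = 1 *)
Definition Hsum (a : R) (F : nat -> set X) : \bar R :=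
  \sum_(k <oo) \int[phi]_(x in (spre S k%:Z (F k) : set X0)) poweR (Z x) a.

Definition Hout (a : R) (Q : set X) : \bar R :=
  ereal_inf (Hsum a @` covers S A Q).

Definition covers1 (e : R) (Q : set X) : set (nat -> set X) :=
  [set F | covers S A Q F /\ Lsum F < Lout Q + e%:E].

(* H^{b,1}; the infimum is nonincreasing in e, so that the limit exists in
   \bar R *)
Definition H1 (b : R) (Q : set X) : \bar R :=
  lim (ereal_inf (Hsum b @` covers1 e Q) @[e --> 0%R^'+]).

Definition coversb1 (b e : R) (Q : set X) : set (nat -> set X) :=
  [set F | covers1 e Q F /\ Hsum b F < H1 b Q + e%:E].

(* lne 0 = -oo and 0 * -oo = 0, so for 0 < a the integrand is 0 where Z is 0.
   For a < 1 the positive parts of the terms are summable over any F in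
   covers1 e Q, so that the series of signed terms has a value in [-oo, +oo[. *)
Definition Dsum (a : R) (F : nat -> set X) : \bar R :=
  \sum_(k <oo) \int[phi]_(x in (spre S k%:Z (F k) : set X0))
    (poweR (Z x) a * lne (Z x)).

(* D^{a,b}_{1,e} *)
Definition D1e (a b e : R) (Q : set X) : \bar R :=
  ereal_inf (Dsum a @` coversb1 b e Q).

(* D^{a,b}_1; again monotone in e *)
Definition D1 (a b : R) (Q : set X) : \bar R :=
  lim (D1e a b e Q @[e --> 0%R^'+]).

End dynamically_defined.

Definition is_right_derive {R : realType} (f : R -> R) (a l : R) : Prop :=
  h^-1 * (f (a + h) - f a) @[h --> 0^'+] --> l.

(* Main.v *)
(* Each weighted sum over the covers of Q defines, as Q varies, an outer measure
   dyn nu, with nu = Z^b phi or nu = Lam. Replacing Q by its iterated preimages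
   under S makes dyn nu grow to an S-invariant outer measure dyninf nu of the
   same finite mass, for which every set of level A_m is Caratheodory
   measurable; hence dyn nu = dyninf nu is an S-invariant measure on B. A
   near-optimal cover for Lam can then be refined, block by block, into one that
   is near-optimal for Z^b phi as well, so that H^{b,1} = H_b on B for 0 < b < 1.
   With h x := H_x(Q), convexity of x |-> Z^x bounds D^{a,a+e}_1 above by
   (h (a + e) - h a) / e, and a second order expansion, whose remainder is
   controlled by D^{a-delta,a}_1 > -oo, bounds this slope above by
   D^{a,a}_1 + O(e). Finally the assumption on e D^{a,a+e}_{1,e} makes covers
   near-optimal for a + e near-optimal for a, so that D^{a,a+e}_1 is eventually
   at least D^{a,a}_{1,eta}, for every eta > 0. *)
From HB Require Import structures.
Require Import Defs.
From mathcomp Require Import all_boot all_order all_algebra.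
From mathcomp Require Import all_classical all_reals all_analysis.
From mathcomp Require Import measurable_realfun.
From mathcomp Require Import ring lra.
Import Order.TTheory GRing.Theory Num.Theory.
Import numFieldNormedType.Exports.
Local Open Scope classical_set_scope.
Local Open Scope ring_scope.

Set Implicit Arguments.
Unset Strict Implicit.
Unset Printing Implicit Defensive.

(** * Real inequalities *)

Section real_inequalities.
Context {R : realType}.
Implicit Types a b c e t x y z : R.

Lemma powR_gt0E z a : 0 < z -> z `^ a = expR (a * ln z).
Proof. by move=> z0; rewrite /powR gt_eqF. Qed.

Lemma mul_expR_ge t c : c * t <= expR (c * t).
Proof. by apply: le_trans (expR_ge1Dx _); rewrite lerDr. Qed.

(** The convex function [x |-> z^x] lies above its tangent at [a]: multiply [1 + y <= expR y], with
    [y = e * ln z], by [z^a]. At [z = 0] all terms vanish. *)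
Lemma powR_ge_tangent a e z : 0 < a -> 0 < e -> 0 <= z ->
  z `^ a + e * (z `^ a * ln z) <= z `^ (a + e).
Proof.
move=> a0 e0; rewrite le_eqVlt => /predU1P[<-|z0].
  by rewrite !powR0 ?gt_eqF ?addr_gt0// mul0r mulr0 addr0.
rewrite !powR_gt0E// mulrDl expRD mulrCA -[X in X + _]mulr1 -mulrDr.
by rewrite ler_wpM2l ?expR_ge0// expR_ge1Dx.
Qed.

(** Multiply [(1 - a) * ln z <= z^(1-a)] by [z^a]. This domination by [z] makes the positive part of
    a signed sum summable over covers of finite [Lam]-weight. *)
Lemma powR_ln_le a z : 0 < a < 1 -> 0 <= z ->
  z `^ a * ln z <= (1 - a)^-1 * z.
Proof.
move=> /andP[a0 a1]; rewrite le_eqVlt => /predU1P[<-|z0].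
  by rewrite powR0 ?gt_eqF// mul0r mulr0.
have a10 : 0 < 1 - a by rewrite subr_gt0.
rewrite ler_pdivlMl// mulrCA.
apply: le_trans (ler_wpM2l (powR_ge0 z a) (mul_expR_ge (ln z) (1 - a))) _.
by rewrite powR_gt0E// -expRD -mulrDl subrKC mul1r lnK.
Qed.

Lemma powR_ln_ge a z : 0 < a -> 0 <= z -> - a^-1 <= z `^ a * ln z.
Proof.
move=> a0; rewrite le_eqVlt => /predU1P[<-|z0].
  by rewrite powR0 ?gt_eqF// mul0r oppr_le0 invr_ge0 ltW.
rewrite lerNl -(ler_pM2l a0) divff ?gt_eqF// powR_gt0E//.
have := ler_wpM2l (expR_ge0 (a * ln z)) (mul_expR_ge (ln z) (- a)).
rewrite -expRD -mulrDl subrr mul0r expR0; apply: le_trans.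
by rewrite mulrN mulNr mulrN mulrCA.
Qed.

(** Cut at the threshold [t] with [t^b = c]: below it [z^b <= c], above it [z^(b-1) <= t^(b-1)]
    because [b < 1]. After integration this is a uniform absolute continuity of [Z^b phi] with
    respect to [Lam]. *)
Lemma powR_le_affine b c : 0 < b < 1 -> 0 < c ->
  exists2 K : R, 0 < K & forall z, 0 <= z -> z `^ b <= c + K * z.
Proof.
move=> /andP[b0 b1] c0; pose t := c `^ b^-1.
have t0 : 0 < t by exact: powR_gt0.
have tb : t `^ b = c by rewrite -powRrM mulVf ?gt_eqF// powRr1// ltW.
exists (t `^ (b - 1)) => [|z z0]; first exact: powR_gt0.
have [zt|tz] := leP z t.
  rewrite -tb; apply: (@le_trans _ _ (t `^ b)).
    by rewrite ge0_ler_powR ?nnegrE// ltW.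
  by rewrite lerDl mulr_ge0// powR_ge0.
have z1 : 0 < z by exact: lt_trans tz.
apply: (@le_trans _ _ (t `^ (b - 1) * z)); last by rewrite lerDr ltW.
rewrite -[X in _ <= _ * X]lnK// !powR_gt0E// -expRD ler_expR.
have : ln t <= ln z by rewrite ler_ln ?posrE// ltW.
by nra.
Qed.

Lemma powR_le1D b z : 0 <= b <= 1 -> 0 <= z -> z `^ b <= 1 + z.
Proof.
move=> /andP[b0 b1] z0; have [z1|z1] := leP z 1.
  have := ge0_ler_powR b0 z0 ler01 z1; rewrite powR1 => zb1.
  by rewrite -[leLHS]addr0 lerD.
by rewrite -[leLHS]add0r lerD// -[leRHS]powRr1// ler_powR// ltW.
Qed.

(** Since [expR (- y) >= 1 - y], it suffices that [(1 + y + y^2)(1 - y) = 1 - y^3 >= 1]. *)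
Lemma expR_le_taylor2_neg y : y <= 0 -> expR y <= 1 + y + y ^+ 2.
Proof.
move=> y0; rewrite -[expR y]invrK -expRN -[leLHS]mul1r.
rewrite ler_pdivrMr ?expR_gt0//.
apply: (@le_trans _ _ ((1 + y + y ^+ 2) * (1 - y))).
  have : 0 <= (- y) ^+ 3 by rewrite exprn_ge0// oppr_ge0.
  by rewrite exprNn; lra.
rewrite ler_wpM2l ?expR_ge1Dx//.
by have := sqr_ge0 (y + 2^-1); lra.
Qed.

(** Substitute [expR y <= 1 + y * expR y] into its own right-hand side. *)
Lemma expR_le_taylor2_pos y : 0 <= y -> expR y <= 1 + y + y ^+ 2 * expR y.
Proof.
move=> y0; have e0 := expR_gt0 y.
have h1 : expR y * (1 - y) <= 1.
  rewrite -[expR y]invrK -expRN mulrC ler_pdivrMr ?expR_gt0// mul1r.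
  exact: expR_ge1Dx.
by nra.
Qed.

(** With [t = ln z], the remainder is at most [e^2 t^2 z^a] for [t <= 0] and [e^2 t^2 z^(a+e)] for
    [t > 0]. In the first case one factor [- t] is absorbed by [- t z^r <= 1/r], which leaves
    [- z^(a-r) ln z]; in the second [t^2] is absorbed by a small power of [z]. *)
Lemma powR_le_taylor2 a r : 0 < r < a -> a < 1 ->
  exists K : R, exists C : R, [/\ 0 <= K, 0 <= C &
  forall e z, 0 < e <= (1 - a) / 2 -> 0 <= z ->
    z `^ (a + e) <= z `^ a + e * (z `^ a * ln z) +
      e ^+ 2 * (K * z - C * (z `^ (a - r) * ln z))].
Proof.
move=> /andP[r0 ra] a1; pose s := (1 - a) / 4.
have a0 : 0 < a by exact: lt_trans ra.
have s0 : 0 < s by rewrite divr_gt0// subr_gt0.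
have ar01 : 0 < a - r < 1 by apply/andP; split; lra.
(* For [t > 0], [s t <= z^s] gives [t^2 <= s^-2 z^(2s)], and [a + e + 2s <= 1]. The second summand
   of [K] compensates the term in [C], which is then negative. *)
exists (s ^- 2 + r^-1 * (1 - (a - r))^-1), r^-1.
have C0 : 0 <= r^-1 by rewrite invr_ge0 ltW.
have K0 : 0 <= (1 - (a - r))^-1 by rewrite invr_ge0; lra.
have KC0 : 0 <= s ^- 2 + r^-1 * (1 - (a - r))^-1.
  by rewrite addr_ge0 ?mulr_ge0// invr_ge0 exprn_ge0// ltW.
split=> // e z /andP[e0 ea].
rewrite le_eqVlt => /predU1P[<-|z0].
  have ae0 : 0 < a + e by exact: addr_gt0.
  have [a_r0 _] := andP ar01; rewrite !powR0 ?gt_eqF//.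
  by rewrite !(mulr0, mul0r, addr0, subr0).
have hD := powR_ln_le ar01 (ltW z0).
have zE : z = expR (ln z) by rewrite lnK.
rewrite !powR_gt0E// in hD *; move: hD; rewrite {}zE expRK.
move: (ln z) => {z z0} t hD.
have -> : expR ((a + e) * t) = expR (a * t) * expR (e * t).
  by rewrite -expRD -mulrDl.
have A0 := expR_ge0 (a * t).
have [t0|t0] := leP t 0.
  have et0 : e * t <= 0 by nra.
  have h1 := ler_wpM2l A0 (expR_le_taylor2_neg et0).
  have aE : expR (a * t) = expR ((a - r) * t) * expR (r * t).
    by rewrite -expRD -mulrDl subrK.
  have h2 : - t * expR (r * t) <= r^-1.
    rewrite -[leRHS]mulr1 ler_pdivlMl//.
    have := ler_wpM2r (expR_ge0 (r * t)) (mul_expR_ge t (- r)).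
    by rewrite -expRD -mulrDl addNr mul0r expR0 mulrA mulrN mulNr.
  have h3 : t ^+ 2 * expR (a * t) <= r^-1 * (- t * expR ((a - r) * t)).
    rewrite aE.
    have : 0 <= (- t * expR ((a - r) * t)) by rewrite mulr_ge0 ?expR_ge0; lra.
    by move=> n0; have := ler_wpM2l n0 h2; lra.
  have h4 : 0 <= (s ^- 2 + r^-1 * (1 - (a - r))^-1) * expR t.
    by rewrite mulr_ge0 ?expR_ge0.
  have e2 : 0 <= e ^+ 2 by rewrite exprn_ge0 ?ltW.
  apply: le_trans h1 _.
  by have := ler_wpM2l e2 (lerD h3 h4); lra.
have et0 : 0 <= e * t by nra.
have h1 := ler_wpM2l A0 (expR_le_taylor2_pos et0).
have h2 : t ^+ 2 * (expR (a * t) * expR (e * t)) <= s ^- 2 * expR t.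
  rewrite ler_pdivlMl ?exprn_gt0//.
  have st : s * t <= expR (s * t) by exact: mul_expR_ge.
  apply: (@le_trans _ _ (expR (s * t) ^+ 2 * (expR (a * t) * expR (e * t)))).
    rewrite [leLHS]mulrA -[X in X * _ <= _]exprMn.
    rewrite ler_wpM2r ?mulr_ge0 ?expR_ge0//.
    by rewrite lerXn2r ?nnegrE ?expR_ge0// mulr_ge0// ltW.
  rewrite expr2 -!expRD ler_expR -!mulrDl.
  by rewrite -[leRHS]mul1r; apply: ler_wpM2r; [exact: ltW|rewrite /s; lra].
apply: le_trans h1 _.
have e2 : 0 <= e ^+ 2 by rewrite exprn_ge0 ?ltW.
have h3 := ler_wpM2l C0 hD.
by have := ler_wpM2l e2 (lerD h2 h3); lra.
Qed.

End real_inequalities.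

(** * Series with signed terms *)

Section signed_series.
Context {R : realType}.
Local Open Scope ereal_scope.

(** The partial sums are those of [c * l], with finite limit, minus those of the nonnegative terms
    [c * l - r]; so the limit exists, possibly [-oo]. *)
Lemma series_dominated_cvg (r l : nat -> R) (c : R) : (0 <= c)%R ->
  (forall k, 0 <= l k)%R -> (forall k, r k <= c * l k)%R ->
  \sum_(k <oo) (l k)%:E < +oo ->
  cvgn (fun n => \sum_(0 <= k < n) (r k)%:E) /\
  \sum_(k <oo) (r k)%:E <= c%:E * \sum_(k <oo) (l k)%:E.
Proof.
move=> c0 l0 rl lfin.
have l0E k : 0 <= (l k)%:E by rewrite lee_fin.
have lf : \sum_(k <oo) (l k)%:E \is a fin_num.
  by rewrite ge0_fin_numE// nneseries_ge0.
have hl : c%:E * \sum_(0 <= k < n) (l k)%:E @[n --> \oo] -->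
    c%:E * \sum_(k <oo) (l k)%:E.
  by apply: cvgeZl => //; exact: is_cvg_nneseries.
pose v k := (c * l k - r k)%R.
have v0 k : 0 <= (v k)%:E by rewrite lee_fin subr_ge0.
have rE : (fun n => \sum_(0 <= k < n) (r k)%:E) =
    (fun n => c%:E * \sum_(0 <= k < n) (l k)%:E - \sum_(0 <= k < n) (v k)%:E).
  apply/funext => n; rewrite !sumEFin -EFinM -EFinB; congr EFin.
  by rewrite mulr_sumr -sumrB; apply: eq_bigr => k _; rewrite /v subKr.
have hr : \sum_(0 <= k < n) (r k)%:E @[n --> \oo] -->
    c%:E * \sum_(k <oo) (l k)%:E - \sum_(k <oo) (v k)%:E.
  rewrite rE; apply: cvgeB => //; last exact: is_cvg_nneseries.
  by rewrite fin_num_adde_defr// fin_numM.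
split; first by apply/cvg_ex; eexists; exact: hr.
rewrite (cvg_lim _ hr)// -[leRHS]adde0 leeD2l// leeNl oppe0.
by apply: nneseries_ge0.
Qed.

Lemma series_tangent_le (p q r l : nat -> R) (c e : R) : (0 <= c)%R ->
  (forall k, 0 <= l k)%R -> (forall k, r k <= c * l k)%R ->
  \sum_(k <oo) (l k)%:E < +oo ->
  (forall k, 0 <= p k)%R -> (forall k, 0 <= q k)%R ->
  (forall k, p k + e * r k <= q k)%R ->
  \sum_(k <oo) (q k)%:E < +oo ->
  e%:E * \sum_(k <oo) (r k)%:E <=
    \sum_(k <oo) (q k)%:E - \sum_(k <oo) (p k)%:E.
Proof.
move=> c0 l0 rl lfin p0 q0 prq qfin.
have [rcvg _] := series_dominated_cvg c0 l0 rl lfin.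
have qf : \sum_(k <oo) (q k)%:E \is a fin_num.
  by rewrite ge0_fin_numE// nneseries_ge0// => *; rewrite lee_fin.
have h1 : e%:E * \sum_(0 <= k < n) (r k)%:E @[n --> \oo] -->
    e%:E * \sum_(k <oo) (r k)%:E by exact: cvgeZl.
have h2 : \sum_(0 <= k < n) (q k)%:E - \sum_(0 <= k < n) (p k)%:E @[n --> \oo]
    --> \sum_(k <oo) (q k)%:E - \sum_(k <oo) (p k)%:E.
  apply: cvgeB; first by rewrite fin_num_adde_defr.
  - by apply: is_cvg_nneseries => *; rewrite lee_fin.
  - by apply: is_cvg_nneseries => *; rewrite lee_fin.
rewrite -(cvg_lim _ h1)// -(cvg_lim _ h2)//; apply: lee_lim.
- by apply/cvg_ex; eexists; exact: h1.
- by apply/cvg_ex; eexists; exact: h2.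
apply: nearW => n; rewrite !sumEFin -EFinM -EFinB lee_fin mulr_sumr -sumrB.
by apply: ler_sum => k _; rewrite lerBrDl.
Qed.

(** The inequality between terms passes to the limit of partial sums. The sums of [p], [l] and [r']
    are finite, so a value [-oo] for the sum of [r] creates no undefined sum. *)
Lemma series_taylor_le (p q r r' l : nat -> R) (c c' e f K C : R) :
  (0 <= c)%R -> (0 <= c')%R -> (0 <= C)%R ->
  (forall k, 0 <= l k)%R -> (forall k, r k <= c * l k)%R ->
  (forall k, r' k <= c' * l k)%R ->
  \sum_(k <oo) (l k)%:E < +oo ->
  (forall k, 0 <= p k)%R -> (forall k, 0 <= q k)%R ->
  (forall k, q k <= p k + e * r k + f * (K * l k - C * r' k))%R ->
  \sum_(k <oo) (p k)%:E < +oo -> -oo < \sum_(k <oo) (r' k)%:E ->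
  \sum_(k <oo) (q k)%:E <= \sum_(k <oo) (p k)%:E +
    e%:E * \sum_(k <oo) (r k)%:E +
    f%:E * (K%:E * \sum_(k <oo) (l k)%:E - C%:E * \sum_(k <oo) (r' k)%:E).
Proof.
move=> c0 c'0 C0 l0 rl r'l lfin p0 q0 qle pfin r'fin.
have [rcvg _] := series_dominated_cvg c0 l0 rl lfin.
have [r'cvg r'le] := series_dominated_cvg c'0 l0 r'l lfin.
have lf : \sum_(k <oo) (l k)%:E \is a fin_num.
  by rewrite ge0_fin_numE// nneseries_ge0// => *; rewrite lee_fin.
have pf : \sum_(k <oo) (p k)%:E \is a fin_num.
  by rewrite ge0_fin_numE// nneseries_ge0// => *; rewrite lee_fin.
have r'f : \sum_(k <oo) (r' k)%:E \is a fin_num.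
  rewrite fin_numElt r'fin/=; apply: le_lt_trans r'le _.
  by rewrite ltey_eq fin_numM.
have lcvg : cvgn (fun n => \sum_(0 <= k < n) (l k)%:E).
  by apply: is_cvg_nneseries => *; rewrite lee_fin.
have pcvg : cvgn (fun n => \sum_(0 <= k < n) (p k)%:E).
  by apply: is_cvg_nneseries => *; rewrite lee_fin.
pose G n := \sum_(0 <= k < n) (p k)%:E + e%:E * \sum_(0 <= k < n) (r k)%:E +
  f%:E * (K%:E * \sum_(0 <= k < n) (l k)%:E - C%:E * \sum_(0 <= k < n) (r' k)%:E).
have h : G n @[n --> \oo] --> \sum_(k <oo) (p k)%:E +
    e%:E * \sum_(k <oo) (r k)%:E +
    f%:E * (K%:E * \sum_(k <oo) (l k)%:E - C%:E * \sum_(k <oo) (r' k)%:E).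
  apply: cvgeD.
  - by rewrite fin_num_adde_defl// fin_numM// fin_numB !fin_numM.
  - apply: cvgeD; [by rewrite fin_num_adde_defr|exact: pcvg|].
    by apply: cvgeZl.
  - apply: cvgeZl => //; apply: cvgeB; first by rewrite fin_num_adde_defr// fin_numM.
    + exact: cvgeZl.
    + exact: cvgeZl.
rewrite -(cvg_lim _ h)//; apply: lee_lim.
- by apply: is_cvg_nneseries => *; rewrite lee_fin.
- by apply/cvg_ex; eexists; exact: h.
apply: nearW => n; rewrite /G !sumEFin -!EFinM -!EFinD lee_fin.
rewrite !mulr_sumr -sumrB mulr_sumr -!big_split/=.
exact: ler_sum.
Qed.

End signed_series.

(** * Dynamically defined outer measures *)

Lemma iter_can {T : Type} (f g : T -> T) n :
  cancel f g -> cancel (iter n f) (iter n g).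
Proof. by move=> fK; elim: n => // n ih x; rewrite iterSr iterS fK ih. Qed.

Lemma lee_nneseries_partial {R : realType} (u : nat -> \bar R) (l : \bar R) :
  (forall n, 0 <= u n)%E -> (forall n, \sum_(0 <= i < n) u i <= l)%E ->
  (\sum_(i <oo) u i <= l)%E.
Proof.
move=> u0 ul; apply: lime_le; first exact: is_cvg_nneseries.
exact: nearW.
Qed.

Section dynamical_measure.
Local Open Scope ereal_scope.
Context {d : measure_display} {R : realType} {Y : measurableType d}.
Variables (S T : Y -> Y).
Hypotheses (ST : cancel S T) (TS : cancel T S) (mS : measurable_fun setT S).

Lemma measurable_iter_preimage n (B : set Y) :
  measurable B -> measurable (iter n S @^-1` B).
Proof.
move=> mB; elim: n => [//|n ih]; rewrite iterfSr comp_preimage.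
by rewrite -[X in measurable X]setTI; exact: mS.
Qed.

(* [E k] stands for S^m A_m with m = -k, so that A_m is [iter k T @^-1` E k]. *)
Definition tcovers (Q : set Y) : set (nat -> set Y) :=
  [set E | (forall k, measurable (E k)) /\
           Q `<=` \bigcup_k (iter k T @^-1` E k)].

Definition delay (k : nat) (E : nat -> set Y) (n : nat) : set Y :=
  if (k <= n)%N then E (n - k)%N else set0.

(** Prefixing [k] empty levels undoes the preimage under [iter k S] without changing the weight.
    This is what makes [dyn] grow along preimages under [S]. *)
Lemma tcovers_delay k E Q :
  tcovers (iter k S @^-1` Q) E -> tcovers Q (delay k E).
Proof.
move=> [mE QE]; split=> [n|x Qx]; first by rewrite /delay; case: ifP.
have [] := QE (iter k T x); first by rewrite /preimage/= iter_can.
move=> j _ /= Ej; exists (k + j)%N => //=.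
by rewrite /delay leq_addr addKn addnC iterD.
Qed.

Lemma tcovers_single k B : measurable B ->
  tcovers (iter k T @^-1` B) (delay k (fun j => if j is 0%N then B else set0)).
Proof.
move=> mB; apply: tcovers_delay; split=> [[]//|x]; rewrite /preimage/=.
by rewrite iter_can// => Bx; exists 0%N.
Qed.

Lemma tcovers_bigcup (Q : nat -> set Y) (E : nat -> nat -> set Y) :
  (forall i, tcovers (Q i) (E i)) ->
  tcovers (\bigcup_i Q i) (fun n => \bigcup_i E i n).
Proof.
move=> QE; split=> [n|x [i _ Qix]].
  by apply: bigcupT_measurable => i; exact: (QE i).1.
by have [k _ Ek] := (QE i).2 x Qix; exists k => //; exists i.
Qed.

(** * The outer measure of one finite measure and its invariant limit *)

Section one_measure.
Variable nu : {finite_measure set Y -> \bar R}.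

Definition wt (E : nat -> set Y) : \bar R := \sum_(k <oo) nu (E k).

Lemma wt_ge0 E : 0 <= wt E.
Proof. exact: nneseries_ge0. Qed.

Lemma le_wt E F : (forall k, measurable (E k)) -> (forall k, measurable (F k)) ->
  (forall k, E k `<=` F k) -> wt E <= wt F.
Proof.
move=> mE mF EF; apply: lee_nneseries => // k _.
by apply: le_measure; rewrite ?inE.
Qed.

Lemma wt_delay k E : wt (delay k E) = wt E.
Proof.
rewrite /wt (nneseries_split _ k)//= add0n.
rewrite (_ : \sum_(0 <= i < k) _ = 0) ?add0e; last first.
  rewrite big_nat big1// => i; rewrite andTb => ik.
  by rewrite /delay leqNgt ik measure0.
rewrite -nneseries_addn//.
by apply: eq_eseriesr => i _; rewrite /delay leq_addl addnK.
Qed.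

Lemma wt_single B : wt (fun j => if j is 0%N then B else set0) = nu B.
Proof.
rewrite /wt nneseries_recl// eseries_cond/= eseries0 ?adde0// => -[|]//= k _ _.
Qed.

Lemma wt_bigcup (E : nat -> nat -> set Y) : (forall i n, measurable (E i n)) ->
  wt (fun n => \bigcup_i E i n) <= \sum_(i <oo) wt (E i).
Proof.
move=> mE; rewrite /wt nneseries_interchange//.
apply: lee_nneseries => // n _; apply: measure_sigma_subadditive => //.
by apply: bigcupT_measurable.
Qed.

Definition dyn (Q : set Y) : \bar R := ereal_inf (wt @` tcovers Q).

Lemma dyn_le_wt Q E : tcovers Q E -> dyn Q <= wt E.
Proof. by move=> QE; apply: ereal_inf_lbound; exists E. Qed.

Lemma dyn_ge0 Q : 0 <= dyn Q.
Proof. by apply: le_ereal_inf_tmp => _ [E _ <-]; exact: wt_ge0. Qed.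

Lemma dyn_le_level k B : measurable B -> dyn (iter k T @^-1` B) <= nu B.
Proof.
by move=> /(tcovers_single k)/dyn_le_wt; rewrite wt_delay wt_single.
Qed.

Lemma le_dyn : {homo dyn : P Q / P `<=` Q >-> P <= Q}.
Proof.
move=> P Q PQ; apply: ereal_inf_le_tmp; apply: image_subset => E [mE QE].
by split=> //; exact: subset_trans QE.
Qed.

Lemma dyn_fin Q : dyn Q \is a fin_num.
Proof.
rewrite ge0_fin_numE ?dyn_ge0//; apply: le_lt_trans (le_dyn (@subsetT _ Q)) _.
apply: le_lt_trans (dyn_le_level 0 measurableT) _.
by rewrite ltey_eq fin_num_measure.
Qed.

Lemma dyn_approx Q (e : R) : (0 < e)%R ->
  exists E, tcovers Q E /\ wt E < dyn Q + e%:E.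
Proof.
move=> e0; have [_ [E QE <-] Ee] := lb_ereal_inf_adherent e0 (dyn_fin Q).
by exists E.
Qed.

Lemma dyn0 : dyn set0 = 0.
Proof.
apply/eqP; rewrite eq_le dyn_ge0 andbT -(measure0 nu).
exact: (dyn_le_level 0 measurable0).
Qed.

(** Take level by level the union of near-optimal covers whose errors form a geometric series. *)
Lemma dyn_sigma_subadditive : sigma_subadditive dyn.
Proof.
move=> Q; apply/lee_addgt0Pr => e e0.
have dQ n : 0 <= dyn (Q n) by exact: dyn_ge0.
apply: (le_trans _ (epsilon_trick xpredT dQ (ltW e0))).
have /choice[E QE] n : exists E, tcovers (Q n) E /\
    wt E < dyn (Q n) + (e / (2 ^ n.+1)%:R)%:E.
  by apply: dyn_approx; rewrite divr_gt0// ltr0n expn_gt0.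
apply: le_trans (dyn_le_wt (tcovers_bigcup (fun n => (QE n).1))) _.
apply: le_trans (wt_bigcup (fun n => (QE n).1.1)) _.
apply: lee_nneseries => [n _ _|n _]; first exact: wt_ge0.
exact: ltW (QE n).2.
Qed.

HB.instance Definition _ := isOuterMeasure.Build R Y dyn
  dyn0 dyn_ge0 le_dyn dyn_sigma_subadditive.

Lemma dyn_caratheodory0 B : measurable B -> dyn.-caratheodory B.
Proof.
move=> mB; apply: le_caratheodory_measurable => P.
apply/lee_addgt0Pr => e e0; have [E [[mE PE] Ee]] := dyn_approx P e0.
apply: (le_trans _ (ltW Ee)).
pose EB (C : set Y) k := E k `&` iter k S @^-1` C.
have mEB C : measurable C -> forall k, measurable (EB C k).
  by move=> mC k; apply: measurableI => //; exact: measurable_iter_preimage.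
have cEB C : measurable C -> tcovers (P `&` C) (EB C).
  move=> mC; split=> [|x [/PE[k _ Ek] Cx]]; first exact: mEB.
  by exists k => //; split=> //; rewrite /preimage/= iter_can.
have := leeD (dyn_le_wt (cEB _ mB)) (dyn_le_wt (cEB _ (measurableC mB))).
move/le_trans; apply; rewrite /wt -nneseriesD//.
apply: lee_nneseries => [k _ _|k _]; first by rewrite adde_ge0.
rewrite -measureU//; [|exact: mEB|exact/mEB/measurableC|].
- apply: le_measure; rewrite ?inE//; last by move=> x [][].
  by apply: measurableU; [exact: mEB|exact/mEB/measurableC].
- by rewrite -subset0 => x [[_ ?] [_]].
Qed.

Lemma dyn_le_shift k Q : dyn Q <= dyn (iter k S @^-1` Q).
Proof.
apply: le_ereal_inf_tmp => _ [E QE <-]; rewrite -(wt_delay k).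
exact/dyn_le_wt/tcovers_delay.
Qed.

Definition dyninf (Q : set Y) : \bar R :=
  ereal_sup (range (fun k => dyn (iter k S @^-1` Q))).

Lemma dyn_shift_nd Q :
  {homo (fun k => dyn (iter k S @^-1` Q)) : m n / (m <= n)%N >-> m <= n}.
Proof.
move=> m n mn; rewrite -(subnK mn) addnC.
apply: le_trans (dyn_le_shift (n - m) _) _.
by apply: le_dyn => x; rewrite /preimage/= -iterD.
Qed.

Lemma dyn_shift_cvg Q : dyn (iter k S @^-1` Q) @[k --> \oo] --> dyninf Q.
Proof. exact/ereal_nondecreasing_cvgn/dyn_shift_nd. Qed.

Lemma dyninf_ge k Q : dyn (iter k S @^-1` Q) <= dyninf Q.
Proof. by apply: ereal_sup_ubound; exists k. Qed.

Lemma dyn_le_inf Q : dyn Q <= dyninf Q.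
Proof. exact: (dyninf_ge 0). Qed.

Lemma dyninf_setT : dyninf setT = dyn setT.
Proof.
apply/eqP; rewrite eq_le dyn_le_inf andbT.
by apply: ge_ereal_sup => _ [k _ <-]; exact: le_dyn.
Qed.

Lemma dyninf0 : dyninf set0 = 0.
Proof.
apply/eqP; rewrite eq_le; apply/andP; split.
  by apply: ge_ereal_sup => _ [k _ <-]; rewrite preimage_set0 dyn0.
by rewrite -dyn0 dyn_le_inf.
Qed.

Lemma dyninf_ge0 Q : 0 <= dyninf Q.
Proof. exact: le_trans (dyn_ge0 Q) (dyn_le_inf Q). Qed.

Lemma le_dyninf : {homo dyninf : P Q / P `<=` Q >-> P <= Q}.
Proof.
move=> P Q PQ; apply: ge_ereal_sup => _ [k _ <-].
by apply: (le_trans _ (dyninf_ge k Q)); apply: le_dyn; exact: preimage_subset.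
Qed.

Lemma dyninf_sigma_subadditive : sigma_subadditive dyninf.
Proof.
move=> Q; apply: ge_ereal_sup => _ [k _ <-]; rewrite preimage_bigcup.
apply: le_trans (dyn_sigma_subadditive _) _.
by apply: lee_nneseries => [n _ _|n _]; [exact: dyn_ge0|exact: dyninf_ge].
Qed.

HB.instance Definition _ := isOuterMeasure.Build R Y dyninf
  dyninf0 dyninf_ge0 le_dyninf dyninf_sigma_subadditive.

(** For [k >= j] the preimage under [iter k S] brings the set back to level 0, where [dyn] splits
    additively; then let [k] tend to infinity. *)
Lemma dyninf_caratheodory j B : measurable B ->
  dyninf.-caratheodory (iter j T @^-1` B).
Proof.
move=> mB; set C := _ @^-1` B.
apply: le_caratheodory_measurable => P.
have h : dyn (iter k S @^-1` (P `&` C)) + dyn (iter k S @^-1` (P `&` ~` C))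
    @[k --> \oo] --> dyninf (P `&` C) + dyninf (P `&` ~` C).
  apply: cvgeD; [|exact: dyn_shift_cvg|exact: dyn_shift_cvg].
  by rewrite ge0_adde_def// inE dyninf_ge0.
rewrite -(cvg_lim _ h)//; apply: lime_le; first by apply/cvg_ex; eexists; exact: h.
exists j => // k /= jk; apply: (le_trans _ (dyninf_ge k P)).
have mD : measurable (iter (k - j) S @^-1` B) by exact: measurable_iter_preimage.
have -> : iter k S @^-1` (P `&` C) =
    iter k S @^-1` P `&` iter (k - j) S @^-1` B.
  rewrite preimage_setI; congr (_ `&` _); apply/funext => x.
  by rewrite /C /preimage/= -{1}(subnKC jk) iterD iter_can.
have -> : iter k S @^-1` (P `&` ~` C) =
    iter k S @^-1` P `&` ~` (iter (k - j) S @^-1` B).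
  rewrite preimage_setI; congr (_ `&` _); apply/funext => x.
  by rewrite /C /preimage/= -{1}(subnKC jk) iterD iter_can.
by rewrite -(dyn_caratheodory0 mD).
Qed.

(* Both are additive over [Q] and its complement (superadditive for the larger
   [dyninf]), and they have the same finite total mass. *)
Lemma dyninfE Q : dyninf.-caratheodory Q -> dyninf Q = dyn Q.
Proof.
move=> cQ; have := cQ setT; rewrite !setTI dyninf_setT => TE.
have Tf : dyninf Q + dyninf (~` Q) \is a fin_num by rewrite -TE dyn_fin.
have [Qf Qcf] : dyninf Q \is a fin_num /\ dyninf (~` Q) \is a fin_num.
  by move: Tf; rewrite fin_numD => /andP.
apply/eqP; rewrite eq_le dyn_le_inf andbT.
rewrite -(leeD2rE (x := dyninf (~` Q)))// -TE.
apply: le_trans (le_outer_measureIC dyn Q setT) _.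
by rewrite !setTI leeD2l// dyn_le_inf.
Qed.

(** The value is squeezed between [dyn Q] and [dyninf Q], which coincide. *)
Lemma dyn_shift k Q : dyninf.-caratheodory Q ->
  dyn (iter k S @^-1` Q) = dyn Q.
Proof.
move=> cQ; apply/eqP; rewrite eq_le dyn_le_shift andbT.
by rewrite -[leRHS]dyninfE// dyninf_ge.
Qed.

End one_measure.

Section caratheodory_generated.
Variable nu : {finite_measure set Y -> \bar R}.

Lemma dyninf_caratheodory_generated (G : set (set Y)) Q :
  (forall B, G B -> (dyninf nu).-caratheodory B) ->
  <<s G >> Q -> (dyninf nu).-caratheodory Q.
Proof.
move=> cG; apply: smallest_sub => //; split.
- exact: caratheodory_measurable_set0.
- by move=> B cB; rewrite setTD; exact: caratheodory_measurable_setC.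
- exact: caratheodory_measurable_bigcup.
Qed.

End caratheodory_generated.

Lemma preimage_iterTS n B : iter n S @^-1` (iter n T @^-1` B) = B.
Proof. by apply/funext => x; rewrite /preimage/= iter_can. Qed.

Lemma preimage_iterT_sub k n B : (k <= n)%N ->
  iter n S @^-1` (iter k T @^-1` B) = iter (n - k) S @^-1` B.
Proof.
move=> kn; apply/funext => x.
by rewrite /preimage/= -{1}(subnKC kn) iterD iter_can.
Qed.

(** Disjointify the traces on [P] of the covering sets. The [k]-th piece involves only levels
    [j <= k], whose preimages under [iter k S] are measurable, so it stays at its level. *)
Lemma tcovers_refine P Q E : measurable P -> Q `<=` P -> tcovers Q E ->
  exists F, [/\ tcovers Q F, forall k, F k `<=` E k,
    forall k, iter k T @^-1` F k `<=` P &
    trivIset setT (fun k => iter k T @^-1` F k)].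
Proof.
move=> mP QP [mE QE].
pose D := seqDU (fun k => P `&` iter k T @^-1` E k).
pose F k := iter k S @^-1` D k.
have FD k : iter k T @^-1` F k = D k.
  by apply/funext => x; rewrite /F /preimage/= iter_can.
have DsubE k : D k `<=` P `&` iter k T @^-1` E k by exact: subset_seqDU.
exists F; split.
- split=> [k|]; last first.
    rewrite (eq_bigcupr (fun k _ => FD k)) -seqDU_bigcup_eq -setI_bigcupr.
    by rewrite subsetI.
  have mC j : (j <= k)%N ->
      measurable (iter k S @^-1` (P `&` iter j T @^-1` E j)).
    move=> jk; rewrite preimage_setI preimage_iterT_sub//.
    by apply: measurableI; exact: measurable_iter_preimage.
  rewrite /F /D /seqDU setDE preimage_setI -preimage_setC.
  rewrite -(bigcup_mkord k (fun j => P `&` iter j T @^-1` E j)).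
  rewrite preimage_bigcup -setDE; apply: measurableD; first exact: mC.
  by apply: bigcup_measurable => j /= jk; exact/mC/ltnW.
- move=> k x Fx; have [_] := DsubE _ _ Fx.
  by rewrite /preimage/= iter_can.
- by move=> k; rewrite FD => x /DsubE[].
- by rewrite (funext FD); exact: trivIset_seqDU.
Qed.

(** * Covers near-optimal for two measures at once *)

Section two_measures.
Variables nu lam : {finite_measure set Y -> \bar R}.
Hypothesis lamS : forall B, measurable B -> lam (S @^-1` B) = lam B.
Hypothesis nu_lam : forall e : R, (0 < e)%R -> exists2 r : R, (0 < r)%R &
  forall B, measurable B -> lam B < r%:E -> nu B <= e%:E.

Lemma invariant_iter n B : measurable B -> lam (iter n S @^-1` B) = lam B.
Proof.
move=> mB; elim: n => // n ih.
by rewrite iterfSr comp_preimage lamS//; exact: measurable_iter_preimage.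
Qed.

Lemma wt_invariant_le (E : nat -> set Y) G : measurable G ->
  (forall k, measurable (E k)) ->
  (forall k, iter k T @^-1` E k `<=` G) ->
  trivIset setT (fun k => iter k T @^-1` E k) -> wt lam E <= lam G.
Proof.
move=> mG mE EG tE; apply: lee_nneseries_partial => // n.
have mF (k : 'I_n) : measurable (iter (n - k) S @^-1` E k).
  by apply: measurable_iter_preimage.
have FE (k : 'I_n) : iter (n - k) S @^-1` E k =
    iter n S @^-1` (iter k T @^-1` E k).
  by rewrite preimage_iterT_sub// ltnW.
rewrite big_mkord.
rewrite (eq_bigr (fun k : 'I_n => lam (iter (n - k) S @^-1` E k))); last first.
  by move=> k _; rewrite invariant_iter.
rewrite -measure_bigsetU_ord//; last first.
  move=> i j _ _ [x []]; rewrite !FE => xi xj; apply/val_inj.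
  by apply: tE => //; exists (iter n S x).
rewrite -(invariant_iter n mG); apply: le_measure; rewrite ?inE.
- exact: bigsetU_measurable.
- exact: measurable_iter_preimage.
- by elim/big_ind : _ => // [B C ? ?|k _]; [rewrite subUset|rewrite FE => x /EG].
Qed.

(** A finite union of covering sets is the preimage under an iterate of [T] of a single measurable
    set of [lam]-mass below [r], to which the hypothesis applies. The bound then passes to the
    countable union. *)
Lemma dyn_abs_cont (e r : R) (P : set Y) :
  (forall B, measurable B -> lam B < r%:E -> nu B <= e%:E) ->
  dyn lam P < r%:E -> dyn nu P <= e%:E.
Proof.
move=> er Pr; have [_ [E [mE PE] <-] Er] := ereal_inf_lt Pr.
pose V n := \big[setU/set0]_(k < n) (iter k T @^-1` E k).
have V_le n : dyn nu (V n) <= e%:E.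
  pose B := \big[setU/set0]_(k < n) (iter (n - k) S @^-1` E k).
  have mB : measurable B.
    by apply: bigsetU_measurable => k _; exact: measurable_iter_preimage.
  have -> : V n = iter n T @^-1` B.
    rewrite /V /B -(bigcup_mkord n (fun k => iter k T @^-1` E k)).
    rewrite -(bigcup_mkord n (fun k => iter (n - k) S @^-1` E k)).
    rewrite preimage_bigcup.
    apply: eq_bigcupr => k /= kn; apply/funext => x; rewrite /preimage/=.
    by rewrite -{2}(subnK (ltnW kn)) iterD iter_can.
  apply: le_trans (dyn_le_level _ _ mB) _; apply: er => //.
  apply: le_lt_trans Er; rewrite /wt.
  apply: (@le_trans _ _ (\sum_(0 <= k < n) lam (E k))); last first.
    exact: nneseries_lim_ge.
  rewrite big_mkord.
  rewrite [leRHS](eq_bigr (fun k : 'I_n => lam (iter (n - k) S @^-1` E k))).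
    apply: (@content_subadditive _ _ _ lam B
      (fun k => iter (n - k) S @^-1` E k) n) => // k _.
    exact: measurable_iter_preimage.
  by move=> k _; rewrite invariant_iter.
have cE k : (dyninf nu).-caratheodory (iter k T @^-1` E k).
  exact: dyninf_caratheodory.
pose D := seqDU (fun k => iter k T @^-1` E k).
have cV n : (dyninf nu).-caratheodory (V n).
  exact: (caratheodory_measurable_bigsetU cE).
have cD k : (dyninf nu).-caratheodory (D k).
  by apply: caratheodory_measurable_setD; [exact: cE|exact: cV].
(* Disjointify the union: partial sums of [dyninf nu] over the pieces equal its value on [V n],
   where it coincides with [dyn nu]. *)
apply: le_trans (le_dyn nu PE) _; rewrite seqDU_bigcup_eq.
apply: le_trans (dyn_le_inf _ _) _.
apply: le_trans (dyninf_sigma_subadditive _ _) _.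
apply: lee_nneseries_partial => [k|n]; first exact: dyninf_ge0.
have VE : dyninf nu (V n) = \sum_(k < n) dyninf nu (D k).
  rewrite -[V n]setTI /V (bigsetU_seqDU (fun k => iter k T @^-1` E k)).
  rewrite [LHS](caratheodory_additive cD (@trivIset_seqDU _ _)).
  by apply: eq_bigr => k _; rewrite setTI.
rewrite big_mkord [leLHS](_ : _ = dyninf nu (V n)); last by rewrite VE.
by rewrite dyninfE.
Qed.

(* [lam] need not extend to an invariant measure on the generated
   sigma-algebra, so the [lam]-weight of the refined cover is compared with
   that of the initial cover [G] block by block, through finite additivity. *)
Lemma dyn_joint_cover (Q : set Y) (e eta : R) :
  (dyninf nu).-caratheodory Q -> (dyninf lam).-caratheodory Q ->
  (0 < e)%R -> (0 < eta)%R ->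
  exists E, [/\ tcovers Q E, wt lam E < dyn lam Q + e%:E &
    wt nu E <= dyn nu Q + eta%:E].
Proof.
move=> nQ lQ e0 eta0; have eta20 : (0 < eta / 2)%R by rewrite divr_gt0.
have [r r0 er] := nu_lam eta20.
(* The part [e] of the tolerance serves the [lam]-weight; the part [r] makes the excess of the cover
   over [Q] so small that its [nu]-value is at most [eta / 2]. *)
have m0 : (0 < Num.min e r)%R by rewrite lt_min e0.
have [G' [QG' G'Q]] := dyn_approx lam Q m0.
have [G [[mG QG] GG' _ tG]] := tcovers_refine measurableT (@subsetT _ Q) QG'.
have GQ : wt lam G < dyn lam Q + (Num.min e r)%:E.
  by apply: le_lt_trans G'Q; apply: le_wt => //; exact: QG'.1.
pose U := \bigcup_k (iter k T @^-1` G k).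
have nG k : (dyninf nu).-caratheodory (iter k T @^-1` G k).
  exact: dyninf_caratheodory.
have lU : (dyninf lam).-caratheodory U.
  by apply: caratheodory_measurable_bigcup => k; exact: dyninf_caratheodory.
have UQ_small : dyn lam (U `&` ~` Q) < r%:E.
  have lUQ : (dyninf lam).-caratheodory (U `&` ~` Q).
    apply: caratheodory_measurable_setI => //.
    exact: caratheodory_measurable_setC.
  have : dyn lam U < dyn lam Q + r%:E.
    apply: le_lt_trans (dyn_le_wt lam (conj mG (@subset_refl _ U))) _.
    by apply: lt_le_trans GQ _; rewrite leeD2l// lee_fin ge_min lexx orbT.
  rewrite -dyninfE// (lQ U) (setIidr QG) !dyninfE//.
  by rewrite lteD2lE// dyn_fin.
have nuU : dyninf nu U <= dyn nu Q + (eta / 2)%:E.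
  rewrite (nQ U) (setIidr QG) (dyninfE nQ) leeD2l// dyninfE.
    exact: dyn_abs_cont UQ_small.
  apply: caratheodory_measurable_setI; last exact: caratheodory_measurable_setC.
  exact: caratheodory_measurable_bigcup.
(* Each block is covered anew, almost optimally for [nu]. Making this cover disjoint inside [G k]
   keeps its [lam]-weight at most [lam (G k)]. *)
have /choice[E PE] k : exists E, [/\ tcovers (G k) E,
    wt nu E <= dyn nu (G k) + (eta / 2 / (2 ^ k.+1)%:R)%:E &
    wt lam E <= lam (G k)].
  have ek0 : (0 < eta / 2 / (2 ^ k.+1)%:R)%R.
    by rewrite divr_gt0// ltr0n expn_gt0.
  have [E [GE /ltW EG]] := dyn_approx nu (G k) ek0.
  have [F [GF FE FG tF]] := tcovers_refine (mG k) (@subset_refl _ (G k)) GE.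
  exists F; split=> //.
    by apply: le_trans EG; apply: le_wt => //; [exact: GF.1|exact: GE.1].
  by apply: wt_invariant_le => //; exact: GF.1.
(* The block [G k] sits at level [k], so its own cover is delayed by [k]. *)
pose D n := \bigcup_k delay k (E k) n.
have mdE k n : measurable (delay k (E k) n).
  by rewrite /delay; case: ifP => // _; have [[]] := PE k.
exists D; split.
- have [] : tcovers U D; last by move=> ? UD; split=> //; exact: subset_trans UD.
  apply: tcovers_bigcup => k; apply: tcovers_delay.
  by rewrite preimage_iterTS; have [] := PE k.
- apply: (@le_lt_trans _ _ (wt lam G)).
    apply: le_trans (wt_bigcup lam mdE) _.
    apply: lee_nneseries => [k _ _|k _]; first exact: wt_ge0.
    by rewrite wt_delay; have [] := PE k.
  by apply: lt_le_trans GQ _; rewrite leeD2l// lee_fin ge_min lexx.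
- apply: le_trans (wt_bigcup nu mdE) _.
  apply: (@le_trans _ _ (\sum_(k <oo) dyn nu (G k) + (eta / 2)%:E)).
    have dG k : 0 <= dyn nu (G k) by exact: dyn_ge0.
    apply: (le_trans _ (epsilon_trick xpredT dG (ltW eta20))).
    apply: lee_nneseries => [k _ _|k _]; first exact: wt_ge0.
    by rewrite wt_delay; have [] := PE k.
  rewrite [X in (dyn nu Q + X%:E)](splitr eta) EFinD addeA leeD2r//.
  apply: le_trans nuU.
  (* The blocks are disjoint in [U], and shift invariance identifies [dyn nu (G k)] with the
     [dyninf nu]-value of the [k]-th one, so these values sum to at most [dyninf nu U]. *)
  have := caratheodory_lime_le nG tG U.
  rewrite setICr outer_measure0 adde0; apply: le_trans.
  apply: lee_nneseries => [k _ _|k _]; first exact: dyn_ge0.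
  have -> : U `&` iter k T @^-1` G k = iter k T @^-1` G k.
    by apply: setIidr => x Gx; exists k.
  rewrite [leRHS](dyninfE (nG k)).
  by rewrite -[leRHS](dyn_shift k)// preimage_iterTS.
Qed.
End two_measures.
End dynamical_measure.

(** * Covers and weighted sums *)

Lemma finite_measure_density {d : measure_display} {R : realType}
    {Y : measurableType d} (mu : {measure set Y -> \bar R}) (f : Y -> R) :
  (forall x, 0 <= f x) -> mu.-integrable [set: Y] (EFin \o f) ->
  exists nu : {finite_measure set Y -> \bar R},
    forall B, nu B = (\int[mu]_(x in B) (f x)%:E)%E.
Proof.
move=> f0 intf; have f0E x : (0 <= (f x)%:E)%E by rewrite lee_fin.
pose nu (B : set Y) := (\int[mu]_(x in B) (f x)%:E)%E.
have nu0 : nu set0 = 0%E by exact: integral_set0.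
have nu_ge0 B : (0 <= nu B)%E by exact: integral_ge0.
have nuD : semi_sigma_additive nu.
  by apply: semi_sigma_additive_nng_induced => //; have /integrableP[] := intf.
have nu_fin : fin_num_fun nu.
  by move=> B mB; apply: integrable_fin_num => //; exact: integrableS intf.
pose m1 := isMeasure.Build _ _ _ nu nu0 nu_ge0 nuD.
pose m : {measure set Y -> \bar R} := HB.pack nu m1.
pose m2 := Measure_isFinite.Build _ _ _ m nu_fin.
pose mf : {finite_measure set Y -> \bar R} := HB.pack (m : set Y -> \bar R) m m2.
by exists mf.
Qed.

Section dynamically_defined_sums.
Local Open Scope ereal_scope.
Context {R : realType} {X : pointedType}.
Variables (S T : X -> X) (A : set (set X)).
Hypotheses (ST : cancel S T) (TS : cancel T S).

Notation X0 := (g_sigma_algebraType (gen0 S A)).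

Lemma measurable_shift : measurable_fun [set: X0] (S : X0 -> X0).
Proof.
apply: (measurability (gen0 S A : set (set X0))); first by [].
move=> _ [_ [n _ [B AB <-]] <-]; rewrite setTI.
apply: sub_sigma_algebra; exists n.+1 => //; exists B => //.
by apply/funext => x; rewrite /= /preimage/= -iterS iterSr.
Qed.

Lemma sigAmE k F :
  sigAm S A (- k%:Z) F <-> exists2 B : set X0, measurable B & F = iter k T @^-1` B.
Proof.
have spreE (B : set X) : spre S (- k%:Z) B = iter k T @^-1` B.
  case: k => [//|k]; apply/seteqP; split=> [_ [x Bx <-]|x Bx].
    by change (B (iter k.+1 T (iter k.+1 S x))); rewrite iter_can.
  by exists (iter k.+1 T x) => //; rewrite iter_can.
split=> [[B mB <-]|[B mB ->]].
  by exists B.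
by exists B.
Qed.

Lemma covers_tcovers Q F : covers S A Q F ->
  tcovers (T : X0 -> X0) Q (fun k => spre S k%:Z (F k) : set X0).
Proof.
move=> [mF QF]; split=> [k|x /QF[k _ Fk]]; last first.
  by exists k => //; rewrite /preimage/= iter_can.
have /sigAmE[B mB ->] := mF k; rewrite (_ : spre S k%:Z _ = B)//.
exact: (preimage_iterTS (Y := X0) ST).
Qed.

Lemma tcovers_covers Q (E : nat -> set X0) : tcovers (T : X0 -> X0) Q E ->
  covers S A Q (fun k => iter k T @^-1` E k).
Proof.
by move=> [mE QE]; split=> // k; apply/sigAmE; exists (E k).
Qed.

(** Generators with nonnegative index are of level 0; the others are images under iterates of [S],
    hence preimages under iterates of [T]. *)
Lemma sigB_caratheodory (nu : {finite_measure set X0 -> \bar R}) Q :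
  sigB S A Q -> (dyninf (S : X0 -> X0) T nu).-caratheodory Q.
Proof.
apply: (@dyninf_caratheodory_generated _ _ X0 S T ST TS nu).
move=> _ [i _ [B AB <-]]; case: i => n /=.
  apply: (@dyninf_caratheodory _ _ X0 S T ST TS measurable_shift nu 0
    (iter n S @^-1` B)).
  by apply: sub_sigma_algebra; exists n => //; exists B.
have -> : [set iter n.+1 S x | x in B] = iter n.+1 T @^-1` B.
  apply/seteqP; split=> [_ [x Bx <-]|x Bx].
    by change (B (iter n.+1 T (iter n.+1 S x))); rewrite iter_can.
  by exists (iter n.+1 T x) => //; rewrite iter_can.
apply: (@dyninf_caratheodory _ _ X0 S T ST TS measurable_shift nu n.+1 B).
by apply: sub_sigma_algebra; exists 0%N => //; exists B.
Qed.

(** The change of variable [E k = S^m A_m], [m = -k], identifies the two kinds of covers, so that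
    [Lout] and [Hout] become instances of [dyn]. *)
Lemma dyn_ereal_inf (nu : {finite_measure set X0 -> \bar R})
    (w : (nat -> set X) -> \bar R) Q :
  (forall F, covers S A Q F ->
    w F = wt nu (fun k => spre S k%:Z (F k) : set X0)) ->
  ereal_inf (w @` covers S A Q) = dyn (T : X0 -> X0) nu Q.
Proof.
move=> wE; congr ereal_inf; apply/seteqP; split=> [_ [F QF <-]|_ [E QE <-]].
  by exists (fun k => spre S k%:Z (F k)); [exact: covers_tcovers|rewrite wE].
have QF := tcovers_covers QE.
exists (fun k => iter k T @^-1` E k) => //; rewrite wE//.
by congr wt; apply/funext => k; exact: (preimage_iterTS (Y := X0) ST).
Qed.

(** * Real-valued density and weighted sums *)

Section density.
Variables (phi Lam : {finite_measure set X0 -> \bar R}) (Z : X -> \bar R).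
Hypothesis Z_RN : RN_version phi Lam Z.
Hypothesis Lam_inv : forall B : set X, sigA0 S A B -> Lam (S @^-1` B) = Lam B.

(** [Z] may be [+oo] on a [phi]-null set; its real-valued version gives the same integrals and
    admits the real inequalities. *)
Let z (x : X0) : R := fine (Z x).

Let Z_ge0 x : 0 <= Z x. Proof. by case: Z_RN. Qed.

Let z_ge0 x : (0 <= z x)%R. Proof. exact: fine_ge0. Qed.

Let mZ : measurable_fun [set: X0] (Z : X0 -> \bar R). Proof. by case: Z_RN. Qed.

Let mz : measurable_fun [set: X0] z.
Proof. by apply: measurableT_comp mZ; exact: fine_measurable. Qed.

Let int_Z : phi.-integrable [set: X0] (Z : X0 -> \bar R).
Proof.
apply/integrableP; split=> //; under eq_integral do rewrite gee0_abs//.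
have [_ _ <-//] := Z_RN.
by rewrite ltey_eq fin_num_measure.
Qed.

Let ae_z : {ae phi, forall x, Z x = (z x)%:E}.
Proof.
have := integrable_ae measurableT int_Z.
by apply: (filterS (Filter := ae_filter_ringOfSetsType phi)) => x /(_ I) Zx; rewrite /z fineK.
Qed.

Let int_z : phi.-integrable [set: X0] (EFin \o z).
Proof.
apply/integrableP; split; first exact/measurable_EFinP.
rewrite (_ : integral _ _ _ = \int[phi]_x `|(Z : X0 -> \bar R) x|).
  by have /integrableP[] := int_Z.
apply: ae_eq_integral => //.
- by apply: measurableT_comp => //; exact/measurable_EFinP.
- exact: measurableT_comp.
- by move: ae_z; apply: (filterS (Filter := ae_filter_ringOfSetsType phi)) => x /= ->.
Qed.

Let int_bound (f : X0 -> R) (c : R) : measurable_fun [set: X0] f ->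
  (forall x, `|f x| <= c * (1 + z x))%R -> phi.-integrable [set: X0] (EFin \o f).
Proof.
move=> mf fle.
have ig : phi.-integrable [set: X0] (EFin \o (fun x => c * (1 + z x))%R).
  rewrite (_ : _ \o _ = fun x => c%:E * ((EFin \o cst 1%R) x + (EFin \o z) x)).
    apply: integrableZl => //; apply: integrableD => //.
    exact: finite_measure_integrable_cst.
  by apply/funext => x /=; rewrite EFinM EFinD.
apply: le_integrable ig => //; first exact/measurable_EFinP.
by move=> x _ /=; rewrite lee_fin; apply: le_trans (fle x) (ler_norm _).
Qed.

Let pw (b : R) (x : X0) : R := (z x `^ b)%R.
Let pl (a : R) (x : X0) : R := (z x `^ a * ln (z x))%R.

Let mpw b : measurable_fun [set: X0] (pw b).
Proof. by apply: (measurableT_comp (measurable_powR _)). Qed.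

Let mpl a : measurable_fun [set: X0] (pl a).
Proof.
apply: measurable_funM; first exact: mpw.
exact: (measurableT_comp (@measurable_ln R)).
Qed.

Let int_pw (b : R) : (0 < b < 1)%R -> phi.-integrable [set: X0] (EFin \o pw b).
Proof.
move=> /andP[b0 b1]; apply: (@int_bound _ 1) => // x.
by rewrite mul1r ger0_norm ?powR_ge0// powR_le1D// !ltW.
Qed.

Let int_pl (a : R) : (0 < a < 1)%R -> phi.-integrable [set: X0] (EFin \o pl a).
Proof.
move=> a01; have /andP[a0 a1] := a01.
apply: (@int_bound _ (a^-1 + (1 - a)^-1)) => // x.
have h1 := powR_ln_le a01 (z_ge0 x); have h2 := powR_ln_ge a0 (z_ge0 x).
have c1 : (0 <= a^-1)%R by rewrite invr_ge0 ltW.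
have c2 : (0 <= (1 - a)^-1)%R by rewrite invr_ge0 subr_ge0 ltW.
have := z_ge0 x => zx0.
have c1z := mulr_ge0 c1 zx0; have c2z := mulr_ge0 c2 zx0.
by rewrite ler_norml; apply/andP; split; rewrite /pl; lra.
Qed.

Let integral_fine (g : X0 -> \bar R) (f : X0 -> R) (B : set X0) :
  measurable B -> phi.-integrable [set: X0] (EFin \o f) ->
  measurable_fun [set: X0] g ->
  (forall x, Z x = (z x)%:E -> g x = (f x)%:E) ->
  \int[phi]_(x in B) g x = (\int[phi]_(x in B) f x)%R%:E.
Proof.
move=> mB intf mg gf.
rewrite /Rintegral fineK; last first.
  by apply: integrable_fin_num => //; exact: integrableS intf.
apply: ae_eq_integral => //.
- exact: measurable_funTS.
- by apply: measurable_funTS; have /integrableP[] := intf.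
- by move: ae_z; apply: (filterS (Filter := ae_filter_ringOfSetsType phi)) => x /gf /= ->.
Qed.

Let Hterm b B : (0 < b < 1)%R -> measurable B ->
  \int[phi]_(x in (B : set X0)) poweR (Z x) b = (\int[phi]_(x in B) pw b x)%R%:E.
Proof.
move=> b01 mB; apply: integral_fine => //; first exact: int_pw.
  exact: (measurableT_comp (measurable_poweR _)).
by move=> x ->; rewrite poweR_EFin.
Qed.

Let Dterm a B : (0 < a < 1)%R -> measurable B ->
  \int[phi]_(x in (B : set X0)) (poweR (Z x) a * lne (Z x)) =
  (\int[phi]_(x in B) pl a x)%R%:E.
Proof.
move=> a01 mB; have /andP[a0 a1] := a01.
have ZE x : Z x = (z x)%:E -> poweR (Z x) a * lne (Z x) = (pl a x)%:E.
  move=> ->; rewrite poweR_EFin /pl.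
  have := z_ge0 x; rewrite le_eqVlt => /predU1P[<-|z0].
    by rewrite powR0 ?gt_eqF// mul0r mul0e.
  by rewrite lne_EFin.
apply: integral_fine => //; first exact: int_pl.
(* Where [Z] is [+oo] so is the product; elsewhere it is real, including the value 0 at [Z = 0]. *)
rewrite (_ : (fun x => _) = fun x : X0 => if Z x == +oo then +oo else (pl a x)%:E).
  apply: measurable_fun_ifT => //; last exact/measurable_EFinP.
  exact: measurable_fun_eqe.
apply/funext => x; case: ifPn => [/eqP->|Zx].
  by rewrite poweRE gt_eqF// eqxx mulyy.
by apply: ZE; rewrite /z fineK// ge0_fin_numE// ltey.
Qed.

Let Lterm (B : set X0) : measurable B -> Lam B = (\int[phi]_(x in B) z x)%R%:E.
Proof.
by move=> mB; have [_ _ ->//] := Z_RN; apply: integral_fine.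
Qed.

Let I (f : X0 -> R) (B : set X0) : R := (\int[phi]_(x in B) f x)%R.

Let level (F : nat -> set X) (k : nat) : set X0 := spre S k%:Z (F k).

Let measurable_level Q F k : covers S A Q F -> measurable (level F k).
Proof. by move=> /covers_tcovers[+ _]; apply. Qed.

Let LsumE Q F : covers S A Q F ->
  Lsum Lam F = \sum_(k <oo) (I z (level F k))%:E.
Proof.
move=> QF; apply: eq_eseriesr => k _.
by rewrite -Lterm//; exact: measurable_level QF.
Qed.

Let HsumE b Q F : (0 < b < 1)%R -> covers S A Q F ->
  Hsum phi Z b F = \sum_(k <oo) (I (pw b) (level F k))%:E.
Proof.
move=> b01 QF; apply: eq_eseriesr => k _.
by rewrite -Hterm//; exact: measurable_level QF.
Qed.

Let DsumE a Q F : (0 < a < 1)%R -> covers S A Q F ->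
  Dsum phi Z a F = \sum_(k <oo) (I (pl a) (level F k))%:E.
Proof.
move=> a01 QF; apply: eq_eseriesr => k _.
by rewrite -Dterm//; exact: measurable_level QF.
Qed.

Let intS f B : measurable B -> phi.-integrable [set: X0] (EFin \o f) ->
  phi.-integrable B (EFin \o f).
Proof. by move=> mB; apply: integrableS. Qed.

Let I_ge0 f B : (forall x, 0 <= f x)%R -> (0 <= I f B)%R.
Proof. by move=> f0; exact: Rintegral_ge0. Qed.

Let I_le f g B : measurable B -> phi.-integrable [set: X0] (EFin \o f) ->
  phi.-integrable [set: X0] (EFin \o g) -> (forall x, f x <= g x)%R ->
  (I f B <= I g B)%R.
Proof. by move=> mB jf jg fg; apply: le_Rintegral => //; exact: intS. Qed.

Let int_lin f g (c : R) : phi.-integrable [set: X0] (EFin \o f) ->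
  phi.-integrable [set: X0] (EFin \o g) ->
  phi.-integrable [set: X0] (EFin \o (fun x => f x + c * g x)%R).
Proof.
move=> jf jg.
have -> : EFin \o (fun x => f x + c * g x)%R =
    (EFin \o f) \+ (fun x => c%:E * (EFin \o g) x).
  by apply/funext => x /=; rewrite EFinD EFinM.
by apply: integrableD => //; exact: integrableZl.
Qed.

Let I_lin f g (c : R) B : measurable B ->
  phi.-integrable [set: X0] (EFin \o f) ->
  phi.-integrable [set: X0] (EFin \o g) ->
  (I (fun x => f x + c * g x) B = I f B + c * I g B)%R.
Proof.
move=> mB jf jg; have jcg : phi.-integrable [set: X0] (EFin \o (fun x => c * g x)%R).
  rewrite (_ : _ \o _ = (fun x => c%:E * (EFin \o g) x)).
    exact: integrableZl.
  by apply/funext => x /=; rewrite EFinM.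
by rewrite /I RintegralD ?RintegralZl//; exact: intS.
Qed.

Let I_pl_le a B : (0 < a < 1)%R -> measurable B ->
  (I (pl a) B <= (1 - a)^-1 * I z B)%R.
Proof.
move=> a01 mB; rewrite -RintegralZl//; last exact: intS.
apply: I_le => //; first exact: int_pl.
  rewrite (_ : _ \o _ = (fun x => (1 - a)^-1%:E * (EFin \o z) x)).
    exact: integrableZl.
  by apply/funext => x /=; rewrite EFinM.
by move=> x; exact: powR_ln_le.
Qed.

Lemma Dsum_le_Lsum a Q F : (0 < a < 1)%R -> covers S A Q F ->
  Lsum Lam F < +oo -> Dsum phi Z a F <= (1 - a)^-1%:E * Lsum Lam F.
Proof.
move=> a01 QF; rewrite (DsumE a01 QF) (LsumE QF) => Lfin.
have a1 : (0 <= (1 - a)^-1)%R.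
  by rewrite invr_ge0 subr_ge0 ltW//; case/andP: a01.
have rl k : (I (pl a) (level F k) <= (1 - a)^-1 * I z (level F k))%R.
  by apply: I_pl_le => //; exact: measurable_level QF.
have l0 k : (0 <= I z (level F k))%R by exact: I_ge0.
exact: (series_dominated_cvg a1 l0 rl Lfin).2.
Qed.

(** The tangent inequality for [x |-> Z^x], integrated on each level and summed. *)
Lemma Dsum_le_Hsum_diff a e Q F : (0 < a < 1)%R -> (0 < e)%R ->
  (a + e < 1)%R -> covers S A Q F -> Lsum Lam F < +oo ->
  Hsum phi Z (a + e) F < +oo ->
  e%:E * Dsum phi Z a F <= Hsum phi Z (a + e) F - Hsum phi Z a F.
Proof.
move=> a01 e0 ae1 QF; have /andP[a0 a1] := a01.
have ae01 : (0 < a + e < 1)%R by rewrite addr_gt0.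
rewrite (DsumE a01 QF) (LsumE QF) (HsumE a01 QF) (HsumE ae01 QF) => Lfin Hfin.
have a1' : (0 <= (1 - a)^-1)%R by rewrite invr_ge0 subr_ge0 ltW.
have mF k := measurable_level k QF.
apply: (series_tangent_le a1' _ _ Lfin) => // k.
- exact: I_ge0.
- exact: I_pl_le.
- by apply: I_ge0 => x; exact: powR_ge0.
- by apply: I_ge0 => x; exact: powR_ge0.
- rewrite -I_lin//; [|exact: int_pw|exact: int_pl].
  apply: I_le => //; [|exact: int_pw|].
    by apply: int_lin; [exact: int_pw|exact: int_pl].
  by move=> x; exact: powR_ge_tangent.
Qed.

Lemma Hsum_taylor_le a r : (0 < r < a)%R -> (a < 1)%R ->
  exists K : R, exists C : R, [/\ (0 <= K)%R, (0 <= C)%R &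
  forall e Q F, (0 < e <= (1 - a) / 2)%R -> covers S A Q F ->
    Lsum Lam F < +oo -> Hsum phi Z a F < +oo -> -oo < Dsum phi Z (a - r) F ->
    Hsum phi Z (a + e) F <= Hsum phi Z a F + e%:E * Dsum phi Z a F +
      (e ^+ 2)%:E * (K%:E * Lsum Lam F - C%:E * Dsum phi Z (a - r) F)].
Proof.
move=> ra a1; have [K [C [K0 C0 KC]]] := powR_le_taylor2 ra a1.
have /andP[r0 r_a] := ra.
exists K, C; split=> // e Q F ea QF; have /andP[e0 e1] := ea.
have a0 : (0 < a)%R by exact: lt_trans r_a.
have a01 : (0 < a < 1)%R by rewrite a0.
have ae01 : (0 < a + e < 1)%R by apply/andP; split; lra.
have ar01 : (0 < a - r < 1)%R by apply/andP; split; lra.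
rewrite (DsumE a01 QF) (LsumE QF) (HsumE a01 QF) (HsumE ae01 QF) (DsumE ar01 QF).
move=> Lfin Hfin Dfin.
have a1' : (0 <= (1 - a)^-1)%R by rewrite invr_ge0 subr_ge0 ltW.
have ar1' : (0 <= (1 - (a - r))^-1)%R by rewrite invr_ge0; lra.
have mF k := measurable_level k QF.
apply: (series_taylor_le a1' ar1' C0 _ _ _ Lfin) => // k.
- exact: I_ge0.
- exact: I_pl_le.
- exact: I_pl_le.
- by apply: I_ge0 => x; exact: powR_ge0.
- by apply: I_ge0 => x; exact: powR_ge0.
have j1 := int_pw a01; have j2 := int_pw ae01.
have j3 := int_pl a01; have j4 := int_pl ar01.
(* Gather the right-hand side into one integral, so that the pointwise expansion applies. *)
rewrite [leRHS](_ : _ = I (fun x => ((pw a x + e * pl a x) +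
    (e ^+ 2 * K) * z x) + - (e ^+ 2 * C) * pl (a - r) x)%R (level F k)); last first.
  rewrite !I_lin//; [by ring| |]; first exact: int_lin.
  by apply: int_lin => //; exact: int_lin.
apply: I_le => //.
  by do 3 (apply: int_lin => //).
by move=> x; apply: le_trans (KC e _ ea (z_ge0 x)) _; rewrite /pw /pl; lra.
Qed.

Lemma Lout_fin_num Q : Lout Lam Q \is a fin_num.
Proof.
by rewrite /Lout (@dyn_ereal_inf Lam)//; apply: (@dyn_fin _ _ X0 S T ST).
Qed.

Let Hmeasure (b : R) : (0 < b < 1)%R ->
  exists2 nu : {finite_measure set X0 -> \bar R},
    (forall Q F, covers S A Q F -> Hsum phi Z b F = wt nu (level F)) &
    (forall B, measurable B -> nu B = (I (pw b) B)%:E).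
Proof.
move=> b01; have [x|nu nuE] := @finite_measure_density _ _ _ phi (pw b) _ (int_pw b01).
  exact: powR_ge0.
have nuI B : measurable B -> nu B = (I (pw b) B)%:E.
  move=> mB; rewrite nuE /I /Rintegral fineK//.
  by apply: integrable_fin_num => //; exact/intS/int_pw.
exists nu => // Q F QF; rewrite (HsumE b01 QF).
by apply: eq_eseriesr => k _; rewrite nuI//; exact: measurable_level QF.
Qed.

Lemma Hout_fin_num b Q : (0 < b < 1)%R -> Hout phi Z b Q \is a fin_num.
Proof.
move=> /Hmeasure[nu HE _]; rewrite /Hout (@dyn_ereal_inf nu); last exact: HE.
exact: (@dyn_fin _ _ X0 S T ST).
Qed.

Lemma covers_joint_approx b e eta Q : (0 < b < 1)%R -> sigB S A Q ->
  (0 < e)%R -> (0 < eta)%R -> exists F, [/\ covers S A Q F,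
    Lsum Lam F < Lout Lam Q + e%:E &
    Hsum phi Z b F <= Hout phi Z b Q + eta%:E].
Proof.
move=> b01 QB e0 eta0; have [nu HE nuI] := Hmeasure b01.
have nu_Lam (c : R) : (0 < c)%R -> exists2 r : R, (0 < r)%R &
    forall B : set X0, measurable B -> Lam B < r%:E -> nu B <= c%:E.
  (* The constant of the affine bound is chosen so that its integral is at most [c / 2], with
     [m + 1] guarding against [m = 0]; the bound [c / 2 / K] on [Lam B] controls the linear part. *)
  move=> c0; pose m := fine (phi setT).
  have m0 : (0 <= m)%R by exact: fine_ge0.
  have c20 : (0 < c / 2 / (m + 1))%R by rewrite !divr_gt0// ltr_wpDl.
  have [K K0 KE] := powR_le_affine b01 c20.
  exists (c / 2 / K)%R => [|B mB]; first by rewrite !divr_gt0.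
  rewrite nuI// (Lterm mB) lte_fin ltr_pdivlMr// mulrC => LB.
  have ic : phi.-integrable [set: X0] (EFin \o cst (c / 2 / (m + 1))%R).
    exact: finite_measure_integrable_cst.
  have := I_le mB (int_pw b01) (int_lin K ic int_z) (fun x => KE _ (z_ge0 x)).
  rewrite I_lin// lee_fin => /le_trans; apply.
  rewrite /I Rintegral_cst// -/(I z B).
  have : (fine (phi B) <= m)%R.
    by rewrite fine_le ?fin_num_measure// le_measure ?inE.
  move=> /(ler_wpM2l (ltW c20)) h; apply: le_trans (lerD h (ltW LB)) _.
  have m1 : ((m + 1)^-1 * m <= 1)%R.
    by rewrite ler_pdivrMl ?ltr_wpDl// mulr1 lerDl.
  have c2 : (0 <= c / 2)%R by rewrite divr_ge0// ltW.
  by have := ler_wpM2l c2 m1; rewrite mulrA mulr1 => ?; lra.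
have LamS (B : set X0) : measurable B -> Lam (S @^-1` B) = Lam B.
  by move=> mB; exact: Lam_inv.
have [E [QE EL EH]] := @dyn_joint_cover _ _ X0 S T ST TS measurable_shift nu Lam
  LamS nu_Lam Q e eta (sigB_caratheodory nu QB) (sigB_caratheodory Lam QB) e0 eta0.
have QF := tcovers_covers QE.
have EF : level (fun k => iter k T @^-1` E k) = E.
  by apply/funext => k; exact: (preimage_iterTS (Y := X0) ST).
exists (fun k => iter k T @^-1` E k); split=> //.
- by rewrite /Lout (@dyn_ereal_inf Lam)// [Lsum _ _](_ : _ = wt Lam E)// -[in RHS]EF.
- by rewrite (HE Q)// EF /Hout (@dyn_ereal_inf nu)//; exact: HE.
Qed.

(** Joint near-optimal covers show that the constraint on the [Lam]-weight does not raise the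
    infimum, so the limit is that of a constant. *)
Lemma H1E b Q : (0 < b < 1)%R -> sigB S A Q ->
  H1 phi Lam Z b Q = Hout phi Z b Q.
Proof.
move=> b01 QB; apply: lim_near_cst => //.
near=> e; have e0 : (0 < e)%R by near: e; exact: nbhs_right_gt.
apply/eqP; rewrite eq_le; apply/andP; split.
  apply/lee_addgt0Pr => eta eta0.
  have [F [QF LF HF]] := covers_joint_approx b01 QB e0 eta0.
  by apply: le_trans HF; apply: ereal_inf_lbound; exists F.
by apply: ereal_inf_le_tmp; apply: image_subset => F [].
Unshelve. all: by end_near.
Qed.

End density.
End dynamically_defined_sums.

(** * The right derivative *)

Section right_derivative.
Local Open Scope ereal_scope.
Context {R : realType} {X : pointedType}.
Variables (S T : X -> X) (A : set (set X)).
Hypotheses (ST : cancel S T) (TS : cancel T S).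

Notation X0 := (g_sigma_algebraType (gen0 S A)).

Variables (phi Lam : {finite_measure set X0 -> \bar R}) (Z : X -> \bar R).
Variable Q : set X.
Hypothesis Z_RN : RN_version phi Lam Z.
Hypothesis Lam_inv : forall B : set X, sigA0 S A B -> Lam (S @^-1` B) = Lam B.
Hypothesis QB : sigB S A Q.

Lemma le_D1e a b e f : (e <= f)%R ->
  D1e phi Lam Z a b f Q <= D1e phi Lam Z a b e Q.
Proof.
move=> ef; apply: ereal_inf_le_tmp; apply: image_subset => F [[QF LF] HF].
have efE : e%:E <= f%:E by rewrite lee_fin.
split; first split=> //; first exact: lt_le_trans (leeD2l _ efE).
exact: lt_le_trans (leeD2l _ efE).
Qed.

Lemma D1e_cvg a b :
  D1e phi Lam Z a b e Q @[e --> 0^'+] --> D1 phi Lam Z a b Q.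
Proof.
apply: nonincreasing_at_right_is_cvge; near=> x => e f _ _.
exact: le_D1e.
Unshelve. all: by end_near.
Qed.

Lemma D1e_le_D1 a b e : (0 < e)%R ->
  D1e phi Lam Z a b e Q <= D1 phi Lam Z a b Q.
Proof.
move=> e0; apply: lime_ge; first by apply/cvg_ex; eexists; exact: D1e_cvg.
by near=> f; apply: le_D1e; apply: ltW; near: f; exact: nbhs_right_lt.
Unshelve. all: by end_near.
Qed.

Lemma D1_le a b M : (forall e : R, (0 < e)%R -> exists2 f : R, (0 < f)%R &
    forall t, (0 < t <= f)%R -> D1e phi Lam Z a b t Q <= M + e%:E) ->
  D1 phi Lam Z a b Q <= M.
Proof.
move=> h; apply/lee_addgt0Pr => e /h[f f0 fM].
apply: lime_le; first by apply/cvg_ex; eexists; exact: D1e_cvg.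
near=> t; apply: fM; apply/andP; split; first by near: t; exact: nbhs_right_gt.
by near: t; exact: nbhs_right_le.
Unshelve. all: by end_near.
Qed.

Variables (h : R -> R) (L : R).
Hypothesis hE : forall x, (0 < x < 1)%R -> Hout phi Z x Q = (h x)%:E.
Hypothesis LE : Lout Lam Q = L%:E.

Let coversb1E x e F : (0 < x < 1)%R -> coversb1 phi Lam Z x e Q F <->
  [/\ covers S A Q F, Lsum Lam F < (L + e)%:E & Hsum phi Z x F < (h x + e)%:E].
Proof.
move=> x01; rewrite /coversb1 /covers1 /= (H1E ST TS Z_RN Lam_inv x01 QB).
by rewrite LE hE// -!EFinD; split=> [[[]]|[]].
Qed.

Let coversb1_nonempty x e : (0 < x < 1)%R -> (0 < e)%R ->
  exists F, coversb1 phi Lam Z x e Q F.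
Proof.
move=> x01 e0; have e20 : (0 < e / 2)%R by rewrite divr_gt0.
have [F [QF LF HF]] := covers_joint_approx ST TS Z_RN Lam_inv x01 QB e0 e20.
exists F; apply/coversb1E => //; split=> //; first by rewrite EFinD -LE.
apply: le_lt_trans HF _; rewrite hE// -EFinD lte_fin ltrD2l.
by rewrite ltr_pdivrMr// ltr_pMr// ltr1n.
Qed.

Let h_le x F : (0 < x < 1)%R -> covers S A Q F -> (h x)%:E <= Hsum phi Z x F.
Proof. by move=> x01 QF; rewrite -hE//; apply: ereal_inf_lbound; exists F. Qed.

Let Hsum_fin x F (y : R) : (0 < x < 1)%R -> covers S A Q F ->
  Hsum phi Z x F < y%:E -> exists2 c : R, Hsum phi Z x F = c%:E & (h x <= c < y)%R.
Proof.
move=> x01 QF; have := h_le x01 QF.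
by case: (Hsum phi Z x F) => // c; rewrite !lee_fin !lte_fin => ? ?;
  exists c => //; apply/andP.
Qed.

Lemma D1_le_slope a e : (0 < a)%R -> (0 < e)%R -> (a + e < 1)%R ->
  D1 phi Lam Z a (a + e) Q <= (e^-1 * (h (a + e) - h a))%:E.
Proof.
move=> a0 e0 ae1; have a01 : (0 < a < 1)%R by apply/andP; split; lra.
have ae01 : (0 < a + e < 1)%R by apply/andP; split; lra.
(* The tolerance [t] of the cover is divided by [e] in the slope, so [t <= e * eta] leaves an error
   of at most [eta]. *)
apply: D1_le => eta eta0; exists (e * eta)%R; first exact: mulr_gt0.
move=> t /andP[t0 te]; have [F cF] := coversb1_nonempty ae01 t0.
apply: (@le_trans _ _ (Dsum phi Z a F)); first by apply: ereal_inf_lbound; exists F.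
have [QF LF HF] := (coversb1E t F ae01).1 cF.
have [c cE /andP[_ ct]] := Hsum_fin ae01 QF HF.
have Lfin : Lsum Lam F < +oo by apply: lt_trans LF _; exact: ltry.
have Hfin : Hsum phi Z (a + e) F < +oo by rewrite cE ltry.
have := Dsum_le_Hsum_diff ST TS Z_RN a01 e0 ae1 QF Lfin Hfin.
rewrite cE => DH.
have : e%:E * Dsum phi Z a F <= (c - h a)%:E.
  by apply: le_trans DH _; rewrite EFinB leeB// h_le.
rewrite -lee_pdivlMl// => /le_trans; apply.
rewrite -EFinM -EFinD lee_fin ler_pdivrMl// mulrDr mulrA mulfV ?gt_eqF// mul1r.
by lra.
Qed.

(** The second order expansion holds with one constant [M] for all covers of tolerance [e0]: their
    [Lam]-weights are bounded above, and their sums of exponent [a - r] are bounded below. *)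
Lemma Hout_le_taylor a : (0 < a < 1)%R ->
  (exists r : R, (0 < r < a)%R /\ -oo < D1 phi Lam Z (a - r) a Q) ->
  exists e0 : R, exists e1 : R, exists M : R,
    [/\ (0 < e0 <= 1)%R, (0 < e1)%R, (a + e1 < 1)%R &
    forall e F, (0 < e <= e1)%R -> coversb1 phi Lam Z a e0 Q F ->
      exists2 u : R, Dsum phi Z a F = u%:E &
        forall c : R, Hsum phi Z a F < c%:E ->
          (h (a + e) <= c + e * u + e ^+ 2 * M)%R].
Proof.
move=> a01 [r [ra Dr]]; have /andP[r0 r_a] := ra; have /andP[a0 a1] := a01.
have ar01 : (0 < a - r < 1)%R by apply/andP; split; lra.
(* Were the infimum [-oo] at every tolerance up to 1, its limit would be [-oo]. The bound [e0 <= 1]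
   keeps [Lam]-weights below [L + 1]. *)
have [e0 e001 De0] : exists2 e0 : R, (0 < e0 <= 1)%R &
    -oo < D1e phi Lam Z (a - r) a e0 Q.
  apply: contrapT => /forall2NP nD.
  suff : D1 phi Lam Z (a - r) a Q <= -oo by rewrite leNgt Dr.
  apply: D1_le => e _; exists 1%R => // t t01; rewrite addNye leeNy_eq.
  by have [//|] := nD t; move=> /negP; rewrite -leNgt leeNy_eq.
have /andP[e00 e01] := e001.
have Dle F : coversb1 phi Lam Z a e0 Q F ->
    D1e phi Lam Z (a - r) a e0 Q <= Dsum phi Z (a - r) F.
  by move=> cF; apply: ereal_inf_lbound; exists F.
have Lsum_fin F : coversb1 phi Lam Z a e0 Q F ->
    exists2 l : R, Lsum Lam F = l%:E & (l <= L + 1)%R.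
  move=> /coversb1E-/(_ a01)[_ LF _].
  have : 0 <= Lsum Lam F by apply: nneseries_ge0 => *; exact: measure_ge0.
  move: LF; case: (Lsum Lam F) => // l; rewrite lte_fin => LF _.
  by exists l => //; lra.
have [m mE] : exists m : R, D1e phi Lam Z (a - r) a e0 Q = m%:E.
  have [F cF] := coversb1_nonempty a01 e00.
  have [l lE _] := Lsum_fin F cF; have [QF LF _] := (coversb1E e0 F a01).1 cF.
  have Lfin : Lsum Lam F < +oo by rewrite lE ltry.
  have := Dsum_le_Lsum ST TS Z_RN ar01 QF Lfin; rewrite lE -EFinM.
  move=> /(le_trans (Dle F cF)); move: De0.
  by case: (D1e _ _ _ _ _ _ _) => // m _ _; exists m.
have [K [C [K0 C0 KC]]] := Hsum_taylor_le ST TS Z_RN ra a1.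
exists e0, ((1 - a) / 2)%R, (K * (L + 1) - C * m)%R; split=> //; [lra|lra|].
move=> e F /[dup] e_le /andP[e_gt0 ee1] cF.
have ae01 : (0 < a + e < 1)%R by apply/andP; split; lra.
have [QF LF HF] := (coversb1E e0 F a01).1 cF.
have [l lE lL] := Lsum_fin F cF.
have [s sE _] := Hsum_fin a01 QF HF.
have Lfin : Lsum Lam F < +oo by rewrite lE ltry.
have Hfin : Hsum phi Z a F < +oo by rewrite sE ltry.
have [v vE mv] : exists2 v : R, Dsum phi Z (a - r) F = v%:E & (m <= v)%R.
  have := Dsum_le_Lsum ST TS Z_RN ar01 QF Lfin; have := Dle F cF.
  rewrite mE lE -EFinM; case: (Dsum _ _ _ _) => // v; rewrite lee_fin => mv _.
  by exists v.
have DF : -oo < Dsum phi Z (a - r) F by rewrite vE ltNyr.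
have := KC e Q F e_le QF Lfin Hfin DF.
move=> /(le_trans (h_le ae01 QF)).
have := Dsum_le_Lsum ST TS Z_RN a01 QF Lfin.
rewrite sE vE lE -!EFinM.
case: (Dsum _ _ _ _) => [u _|//|_].
  rewrite -EFinM -!EFinD lee_fin => hu; exists u => // c; rewrite lte_fin => sc.
  have e2 : (0 <= e ^+ 2)%R by rewrite exprn_ge0// ltW.
  have h1 : (K * l <= K * (L + 1))%R by rewrite ler_wpM2l.
  have h2 : (C * m <= C * v)%R by rewrite ler_wpM2l.
  have h3 : (K * l - C * v <= K * (L + 1) - C * m)%R by lra.
  by have := ler_wpM2l e2 h3; lra.
(* A sum equal to [-oo] would force [h (a + e) <= -oo]. *)
by rewrite gt0_muleNy ?lte_fin// addeNy addNye.
Qed.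

Lemma D1_fin_num_taylor a : (0 < a < 1)%R ->
  (exists r : R, (0 < r < a)%R /\ -oo < D1 phi Lam Z (a - r) a Q) ->
  exists d : R, D1 phi Lam Z a a Q = d%:E /\
    exists e1 : R, exists M : R, [/\ (0 < e1)%R, (a + e1 < 1)%R &
      forall e, (0 < e <= e1)%R -> (h (a + e) <= h a + e * d + e ^+ 2 * M)%R].
Proof.
move=> a01 /(Hout_le_taylor a01)[e0 [e1 [M [/andP[e00 e01] e10 ae1 hM]]]].
have [a0 a1] := andP a01.
have e11 : (0 < e1 <= e1)%R by rewrite e10 lexx.
have ae01 : (0 < a + e1 < 1)%R by apply/andP; split; lra.
have [d dE] : exists d : R, D1 phi Lam Z a a Q = d%:E.
  (* The expansion at the single increment [e1], solved for [u], bounds all sums over covers of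
     tolerance [e0] from below. *)
  have lb : (e1^-1 * (h (a + e1) - h a - e0 - e1 ^+ 2 * M))%:E <=
      D1 phi Lam Z a a Q.
    apply: le_trans (D1e_le_D1 _ _ e00).
    apply: le_ereal_inf_tmp => _ [F cF <-].
    have [u -> /(_ (h a + e0)%R) hu] := hM e1 F e11 cF.
    have [_ _ HF] := (coversb1E e0 F a01).1 cF.
    by rewrite lee_fin ler_pdivrMl//; have := hu HF; lra.
  have ub : D1 phi Lam Z a a Q <= ((1 - a)^-1 * (L + 1))%R%:E.
    apply: D1_le => e e_gt0; exists 1%R => // t /andP[t0 t1].
    have [F cF] := coversb1_nonempty a01 t0.
    have [QF LF HF] := (coversb1E t F a01).1 cF.
    have Lfin : Lsum Lam F < +oo by apply: lt_trans LF (ltry _).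
    apply: (@le_trans _ _ (Dsum phi Z a F)).
      by apply: ereal_inf_lbound; exists F.
    apply: le_trans (Dsum_le_Lsum ST TS Z_RN a01 QF Lfin) _.
    rewrite EFinM; apply: (@le_trans _ _ ((1 - a)^-1%:E * (L + 1)%:E)).
      apply: lee_wpmul2l; first by rewrite lee_fin invr_ge0; lra.
      by apply: le_trans (ltW LF) _; rewrite lee_fin; lra.
    by rewrite leeDl// lee_fin ltW.
  by move: lb ub; case: (D1 _ _ _ _ _ _) => // d _ _; exists d.
exists d; split=> //; exists e1, M; split=> // e /[dup] e_le /andP[e_gt0 _].
(* A cover of tolerance [t] whose signed sum is below [d + t] costs an error [t] in the [a]-sum and
   [e * t] in the linear term, in total at most [eta]. *)
apply/ler_addgt0Pr => eta eta0; pose t := Num.min e0 (eta / (1 + e))%R.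
have e1_gt0 : (0 < 1 + e)%R by lra.
have t0 : (0 < t)%R by rewrite lt_min e00 divr_gt0.
have te0 : (t <= e0)%R by rewrite ge_min lexx.
have teta : (t * (1 + e) <= eta)%R.
  by rewrite -ler_pdivlMr// ge_min lexx orbT.
have : D1e phi Lam Z a a t Q < (d + t)%:E.
  apply: le_lt_trans (D1e_le_D1 _ _ t0) _.
  by rewrite dE lte_fin ltrDl.
move=> /ereal_inf_lt[_ [F cF <-] DF].
have cF0 : coversb1 phi Lam Z a e0 Q F.
  move: cF => /(coversb1E t F a01)[QF LF HF].
  apply/(coversb1E e0 F a01); split=> //.
    by apply: lt_le_trans LF _; rewrite lee_fin lerD2l.
  by apply: lt_le_trans HF _; rewrite lee_fin lerD2l.
have [u uE /(_ (h a + t)%R) hu] := hM e F e_le cF0.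
have [_ _ HF] := (coversb1E t F a01).1 cF.
move: DF; rewrite uE lte_fin => ud; have := hu HF.
by have := ler_wpM2l (ltW e_gt0) (ltW ud); lra.
Qed.

(* A cover optimal for [a + e] is nearly optimal for [a]: by convexity its
   [a]-sum exceeds [h (a + e) + e] by at most [- e * D1e], which is [o(1)]. *)
Lemma D1e_le_D1_near a eta : (0 < a < 1)%R -> (0 < eta)%R ->
  (exists r : R, (0 < r < a)%R /\ -oo < D1 phi Lam Z (a - r) a Q) ->
  e%:E * D1e phi Lam Z a (a + e) e Q @[e --> 0^'+] --> 0 ->
  \forall e \near 0^'+,
    D1e phi Lam Z a a eta Q <= D1 phi Lam Z a (a + e) Q.
Proof.
move=> a01 eta0 Dr eD; have [a0 a1] := andP a01.
have [d [dE [e1 [M [e10 ae1 hM]]]]] := D1_fin_num_taylor a01 Dr.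
(* Three errors, each at most [eta / 4], separate the [a]-sum from [h a]: the tolerance [e], the
   term [e * D1e], and the growth [e * d + e^2 * M] of [h]. *)
have eta4 : (0 < eta / 4)%R by rewrite divr_gt0.
have [eDfin /cvgr0Pnorm_le/(_ _ eta4) eD4] := (fine_cvgP _ _).1 eD.
pose B := (`|d| + `|M| + 1)%R.
have B0 : (0 < B)%R by rewrite ltr_wpDl// addr_ge0.
near=> e.
have e_gt0 : (0 < e)%R by near: e; exact: nbhs_right_gt.
have ee1 : (e <= e1)%R by near: e; exact: nbhs_right_le.
have e_1 : (e <= 1)%R by near: e; exact: nbhs_right_le.
have e4 : (e <= eta / 4)%R by near: e; exact: nbhs_right_le.
have eB : (e <= eta / 4 / B)%R by near: e; apply: nbhs_right_le; rewrite divr_gt0.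
have Dfin : e%:E * D1e phi Lam Z a (a + e) e Q \is a fin_num by near: e.
have D4 : (`|fine (e%:E * D1e phi Lam Z a (a + e) e Q)| <= eta / 4)%R by near: e.
have ae01 : (0 < a + e < 1)%R by apply/andP; split; lra.
(* Using the tolerance [e] itself matches the quantity whose limit is assumed to be 0. *)
apply: le_trans (D1e_le_D1 _ _ e_gt0).
apply: ereal_inf_le_tmp; apply: image_subset => F cF.
have [QF LF HF] := (coversb1E e F ae01).1 cF.
apply/(coversb1E eta F a01); split=> //.
  by apply: lt_trans LF _; rewrite lte_fin; lra.
have [c cE /andP[_ ch]] := Hsum_fin ae01 QF HF.
have Lfin : Lsum Lam F < +oo by apply: lt_trans LF (ltry _).
have Hfin : Hsum phi Z (a + e) F < +oo by rewrite cE ltry.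
have DH := Dsum_le_Hsum_diff ST TS Z_RN a01 e_gt0 (andP ae01).2 QF Lfin Hfin.
have : (- (eta / 4))%:E <= e%:E * Dsum phi Z a F.
  apply: (@le_trans _ _ (e%:E * D1e phi Lam Z a (a + e) e Q)).
    by rewrite -(fineK Dfin) lee_fin; move: D4; rewrite ler_norml => /andP[].
  apply: lee_wpmul2l; first by rewrite lee_fin ltW.
  by apply: ereal_inf_lbound; exists F.
move=> /le_trans/(_ DH); rewrite cE.
have := h_le a01 QF; case: (Hsum phi Z a F) => // p _.
rewrite -EFinB lee_fin lte_fin => cp.
have he := hM e (introT andP (conj e_gt0 ee1)).
have hB : (e * d + e ^+ 2 * M <= eta / 4)%R.
  apply: (@le_trans _ _ (e * B)%R); last by rewrite -ler_pdivlMr.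
  rewrite expr2 -mulrA -mulrDr ler_wpM2l ?ltW// /B.
  have : (e * M <= `|M|)%R.
    by apply: le_trans (ler_norm _) _; rewrite normrM gtr0_norm// ler_piMl.
  by have := ler_norm d; lra.
by lra.
Unshelve. all: by end_near.
Qed.

End right_derivative.

Unset Implicit Arguments.

Theorem theorem3 (R : realType) (X : pointedType) (S : X -> X)
    (A : set (set X))
    (phi Lam : {finite_measure set (g_sigma_algebraType (gen0 S A)) -> \bar R})
    (Z : X -> \bar R) (Q : set X) (alpha0 : R)
    (S_bij : bijective S)
    (A_sigma : sigma_algebra setT A)
    (Lam_inv : forall B : set X, sigA0 S A B -> Lam (S @^-1` B) = Lam B)
    (Lam_phi : Lam `<< phi)
    (Z_RN : RN_version phi Lam Z)
    (QB : sigB S A Q)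
    (alpha0_01 : 0 < alpha0 < 1)
    (D_gtNy : exists delta : R, 0 < delta < alpha0 /\
       (-oo < D1 phi Lam Z (alpha0 - delta) alpha0 Q)%E)
    (eD_cvg0 :
       (e%:E * D1e phi Lam Z alpha0 (alpha0 + e) e Q)%E @[e --> 0^'+]
         --> 0%E) :
  (forall x : R, 0 < x < 1 -> Hout phi Z x Q \is a fin_num) /\
  exists d : R,
    [/\ is_right_derive (fun x => fine (Hout phi Z x Q)) alpha0 d,
        D1 phi Lam Z alpha0 alpha0 Q = d%:E &
        D1 phi Lam Z alpha0 x Q @[x --> alpha0^'+] --> d%:E].
Proof.
have [T ST TS] := S_bij.
split=> [x x01|]; first exact: (Hout_fin_num ST TS Z_RN).
set h := (fun x => fine (Hout phi Z x Q)).
have hE x : 0 < x < 1 -> Hout phi Z x Q = (h x)%:E.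
  by move=> x01; rewrite /h fineK// (Hout_fin_num ST TS Z_RN).
clearbody h.
have LE : Lout Lam Q = (fine (Lout Lam Q))%:E.
  by rewrite fineK// (Lout_fin_num ST TS).
have [d [dE [e1 [M [e10 ae1 hM]]]]] :=
  D1_fin_num_taylor ST TS Z_RN Lam_inv QB hE LE alpha0_01 D_gtNy.
have [a0 a1] := andP alpha0_01.
(* The chain [d - eta <= D1 <= slope <= d + eta] gives both limits at once. *)
have sandwich (eta : R) : 0 < eta -> \forall e \near 0^'+,
    ((d - eta)%:E <= D1 phi Lam Z alpha0 (alpha0 + e) Q)%E /\
    (D1 phi Lam Z alpha0 (alpha0 + e) Q <=
      (e^-1 * (h (alpha0 + e) - h alpha0))%:E)%E /\
    e^-1 * (h (alpha0 + e) - h alpha0) <= d + eta.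
  move=> eta0.
  have [f [f0 fd]] : exists f : R, 0 < f /\
      ((d - eta)%:E <= D1e phi Lam Z alpha0 alpha0 f Q)%E.
    apply: contrapT => /forallNP nf.
    have : (D1 phi Lam Z alpha0 alpha0 Q <= (d - eta)%:E)%E.
      apply: D1_le => e e0; exists 1 => // t /andP[t0 _].
      have := nf t; rewrite not_andE => -[//|/negP].
      rewrite -ltNge => /ltW/le_trans; apply.
      by rewrite leeDl// lee_fin ltW.
    by rewrite dE lee_fin; lra.
  have M0 : 0 < `|M| + 1 by rewrite ltr_wpDl.
  have near_le := D1e_le_D1_near ST TS Z_RN Lam_inv QB hE LE alpha0_01 f0 D_gtNy eD_cvg0.
  near=> e.
  have e_gt0 : 0 < e by near: e; exact: nbhs_right_gt.
  have ee1 : e <= e1 by near: e; exact: nbhs_right_le.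
  have eM : e <= eta / (`|M| + 1).
    by near: e; apply: nbhs_right_le; rewrite divr_gt0.
  split; first by apply: le_trans fd _; near: e.
  split; first by apply: (D1_le_slope ST TS Z_RN Lam_inv QB hE LE) => //; lra.
  have he := hM e (introT andP (conj e_gt0 ee1)).
  (* The expansion bounds the slope by [d + e * M], and [e * M <= eta] by the choice of [e]. *)
  rewrite ler_pdivrMl// mulrDr.
  have : e * (e * M) <= e * eta.
    apply: ler_wpM2l; first exact: ltW.
    move: eM; rewrite ler_pdivlMr// => eM; apply: (le_trans _ eM).
    by apply: ler_wpM2l; [exact: ltW|have := ler_norm M; lra].
  by lra.
exists d; split=> //.
- apply/cvgrPdist_le => eta eta0; near=> e.
  have [] : ((d - eta)%:E <= D1 phi Lam Z alpha0 (alpha0 + e) Q)%E /\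
    (D1 phi Lam Z alpha0 (alpha0 + e) Q <=
      (e^-1 * (h (alpha0 + e) - h alpha0))%:E)%E /\
    e^-1 * (h (alpha0 + e) - h alpha0) <= d + eta by near: e; exact: sandwich.
  move=> dl [lu ud]; have := le_trans dl lu; rewrite lee_fin => du.
  by rewrite distrC ler_distl du.
(* Translate the estimate through [x = alpha0 + e]; with [eta = 1] it also shows that [D1] is finite
   near [alpha0]. *)
- have sandwichx (eta : R) : 0 < eta -> \forall x \near alpha0^'+,
      ((d - eta)%:E <= D1 phi Lam Z alpha0 x Q <= (d + eta)%:E)%E.
    move=> /sandwich; rewrite !near_withinE => /nbhs_ballP[r r0 rS].
    apply/nbhs_ballP; exists r => // x /= xr ax.
    have [] := rS (x - alpha0) _ _.
    + by rewrite /ball/= sub0r normrN distrC.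
    + by rewrite subr_gt0.
    + rewrite subrKC => -> [/le_trans leD ud].
      by apply: leD; rewrite lee_fin.
  apply/fine_cvgP; split.
    near=> x; have /andP[] : ((d - 1)%:E <= D1 phi Lam Z alpha0 x Q <=
      (d + 1)%:E)%E by near: x; exact: sandwichx.
    by case: (D1 _ _ _ _ _ _).
  apply/cvgrPdist_le => eta eta0; near=> x.
  have /andP[] : ((d - eta)%:E <= D1 phi Lam Z alpha0 x Q <=
    (d + eta)%:E)%E by near: x; exact: sandwichx.
  rewrite /=; case: (D1 _ _ _ _ _ _) => // y; rewrite !lee_fin /= => dy yd.
  by rewrite distrC ler_distl dy.
Unshelve. all: by end_near.
Qed.
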